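(* Let $\alpha>0$, $0<p<\infty$, and let $\mu$ be a nonnegative Borel measure on $\mathbb{C}$. Then the following statements are equivalent: (i) $\mu$ is an $(\infty,p)$ Fock--Carleson measure; (ii) $\mu$ is an $(\infty,p)$ vanishing Fock--Carleson measure; (iii) $\widetilde{\mu_{(t,\alpha)}}\in L^1(\mathbb{C},dm)$ for some (or any) $t>0$; (iv) $\mu$ is a finite measure on $\mathbb{C}$; (v) the function $z\mapsto\mu(D(z,r))$ belongs to $L^1(\mathbb{C},dm)$ for some (or any) $r>0$; (vi) the sequence $\big(\mu(D(z_k,r))\big)_k$ belongs to $\ell^1$ for some (or any) $r>0$. Moreover, for $t,\delta,r>0$, $$\|I_\mu\|^p\simeq\|\widetilde{\mu_{(t,\alpha)}}\|_{L^1(dm)}\simeq\|\mu(D(\cdot,\delta))\|_{L^1(dm)}\simeq\|(\mu(D(z_k,r)))_k\|_{\ell^1}.$$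
   Context: $dm$ is Lebesgue measure on $\mathbb{C}$. $\mathcal{F}_\alpha^\infty$ is the space of entire functions $f$ with $\|f\|_{(\infty,\alpha)}=\sup_{z\in\mathbb{C}}|f(z)|e^{-\frac{\alpha}{2}|z|^2}<\infty$. A nonnegative measure $\mu$ on $\mathbb{C}$ is an $(\infty,p)$ Fock--Carleson measure if there is a constant $C$ with $$\Big(\int_{\mathbb{C}}|f(z)|^pe^{-\frac{p\alpha}{2}|z|^2}d\mu(z)\Big)^{1/p}\le C\|f\|_{(\infty,\alpha)}\quad\text{for all }f\in\mathcal{F}_\alpha^\infty,$$ i.e. if the embedding $I_\mu:\mathcal{F}_\alpha^\infty\to L^p\big(e^{-\frac{p\alpha}{2}|z|^2}d\mu(z)\big)$, $f\mapsto f$, is bounded; $\|I_\mu\|$ is the smallest such $C$. It is an $(\infty,p)$ vanishing Fock--Carleson measure if $I_\mu$ is compact. Let $k_{(w,\alpha)}(z)=e^{\alpha\langle z,w\rangle-\alpha|w|^2/2}$ with $\langle z,w\rangle=z\overline{w}$. The $t$-Berezin transform of $\mu$ is $$\widetilde{\mu_{(t,\alpha)}}(w)=\int_{\mathbb{C}}|k_{(w,\alpha)}(z)|^te^{-\frac{\alpha t}{2}|z|^2}d\mu(z).$$ $D(z,\delta)$ is the Euclidean disc with centre $z$ and radius $\delta$. For each $r>0$, $(z_k)$ denotes a fixed sequence in $\mathbb{C}$ (associated with $r$) such that the discs $D(z_k,r/2)$ cover $\mathbb{C}$ and the discs $D(z_k,r/4)$ are pairwise disjoint. ''For some (or any)''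 means that the condition holds for one value of the parameter if and only if it holds for all values. $U\simeq V$ means $C^{-1}V\le U\le CV$ for a constant $C>0$ not depending on $\mu$ (it may depend on $p,\alpha,t,\delta,r$). *)

(* Defs.v *)
From HB Require Import structures.
From mathcomp Require Import all_boot all_order all_algebra.
From mathcomp Require Import complex.
From mathcomp Require Import all_classical all_reals all_analysis.
From mathcomp Require Import lra.
Set Implicit Arguments.
Unset Strict Implicit.
Unset Printing Implicit Defensive.
Import Order.TTheory GRing.Theory Num.Theory.
Import numFieldNormedType.Exports ComplexField.Normc.
Local Open Scope classical_set_scope.
Local Open Scope ring_scope.
Local Open Scope complex_scope.

(* R[i] with its usual topology, as a normed space over itself, so that
   [derivable f z 1] is complex differentiability, and with its Borel
   sigma-algebra. *)
HB.instance Definition _ (R : realType) := PseudoPointedMetric.copy R[i] R[i]^o.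
HB.instance Definition _ (R : realType) := NormedModule.copy R[i] R[i]^o.
HB.instance Definition _ (R : realType) :=
  Measurable.copy R[i] (g_sigma_algebraType (@open R[i])).

Section Complex.
Variable R : realType.
Implicit Types (x y : R) (z w : R[i]).

Definition complex_of_pair (xy : R * R) : R[i] := xy.1 +i* xy.2.

Lemma normC_lt x y e :
  `|x| < e / 2 -> `|y| < e / 2 -> `|x +i* y : R[i]| < e%:C.
Proof.
move=> xe ye; rewrite (_ : x +i* y = x%:C + 'i * y%:C); last first.
  by simpc.
apply: le_lt_trans (ler_normD _ _) _.
rewrite normrM (normc_def (Complex 0 1))/= expr0n expr1n add0r sqrtr1 mul1r.
rewrite !normc_def /= expr0n !addr0 !sqrtr_sqr -rmorphD/= ltcR.
by rewrite [ltRHS](splitr e) ltrD.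
Qed.

Lemma measurable_complex_of_pair : measurable_fun setT complex_of_pair.
Proof.
apply: (@measurability _ _ _ _ _ _ (@open R[i])) => //.
move=> _ [U oU <-]; rewrite setTI; set V := _ @^-1` _.
pose box (a b c d : rat) : set (R * R) :=
  `]ratr a, ratr b[%classic `*` `]ratr c, ratr d[%classic.
pose F a b c d := if `[< box a b c d `<=` V >] then box a b c d else set0.
suff -> : V = \bigcup_a \bigcup_b \bigcup_c \bigcup_d F a b c d.
  do 4 apply: bigcupT_measurable_rat => ?.
  by rewrite /F; case: ifP => // _; exact: measurableX.
apply/seteqP; split=> [[x y] Vxy|xy [a _ [b _ [c _ [d _]]]]]; last first.
  by rewrite /F; case: ifP => // /asboolP; exact.
have : nbhs (x +i* y) U by rewrite nbhsE/=; exists U.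
rewrite -nbhs_ballE => -[e /= e0 eU].
have [e' e'0 ee'] : exists2 e', 0 < e' & e = e'%:C.
  case: e e0 {eU} => a b; rewrite ltcE/= => /andP[/eqP -> a0].
  by exists a.
have e2 : 0 < e' / 2 by rewrite divr_gt0.
have /rat_in_itvoo[a] : x - e' / 2 < x by rewrite ltrBlDr ltrDl.
rewrite in_itv/= => /andP[a1 a2].
have /rat_in_itvoo[b] : x < x + e' / 2 by rewrite ltrDl.
rewrite in_itv/= => /andP[b1 b2].
have /rat_in_itvoo[c] : y - e' / 2 < y by rewrite ltrBlDr ltrDl.
rewrite in_itv/= => /andP[c1 c2].
have /rat_in_itvoo[d] : y < y + e' / 2 by rewrite ltrDl.
rewrite in_itv/= => /andP[d1 d2].
exists a => //; exists b => //; exists c => //; exists d => //.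
rewrite /F asboolT/=; first by rewrite /box; split; rewrite /= in_itv/= ?a2 ?c2.
move=> [u v] [] /=; rewrite !in_itv/= => /andP[au ub] /andP[cv vd].
apply: eU; rewrite -ball_normE/= ee'.
rewrite (_ : _ - _ = (x - u) +i* (y - v)); last by simpc.
by apply: normC_lt; rewrite ltr_norml; apply/andP; split; lra.
Qed.

Definition complex_lebesgue : set R[i] -> \bar R :=
  pushforward (lebesgue_measure \x lebesgue_measure)%E complex_of_pair.

HB.instance Definition _ := Measure.copy complex_lebesgue
  (measure_function_pushforward__canonical__measure_function_Measure
    (lebesgue_measure \x lebesgue_measure)%E measurable_complex_of_pair).

Definition disc z (r : R) : set R[i] := ball z r%:C.

Definition cexp z : R[i] :=
  (expR (complex.Re z))%:C * (cos (complex.Im z) +i* sin (complex.Im z)).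

Definition entire (f : R[i] -> R[i]) := forall z, derivable f z 1.

Section Fock.
Variable alpha : R.

Definition fock_norm (f : R[i] -> R[i]) : \bar R :=
  ereal_sup (range (fun z =>
    (normc (f z) * expR (- (alpha / 2) * normc z ^+ 2))%:E)).

Definition fock_space (f : R[i] -> R[i]) :=
  entire f /\ (fock_norm f < +oo)%E.

Definition fock_kernel w z : R[i] :=
  cexp (alpha%:C * (z * conjc w) - (alpha * normc w ^+ 2 / 2)%:C).

Section CarlesonMeasures.
Variables (p : R) (mu : {measure set R[i] -> \bar R}).

(* Norm of L^p (e^(- p alpha |z|^2 / 2) dmu); only a quasi-norm for p < 1 *)
Definition weighted_norm (g : R[i] -> R[i]) : \bar R :=
  ((\int[mu]_z (normc (g z) `^ p
      * expR (- (p * alpha / 2) * normc z ^+ 2))%:E) `^ p^-1)%E.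

Definition weighted_Lp (g : R[i] -> R[i]) :=
  measurable_fun setT g /\ (weighted_norm g < +oo)%E.

Definition embedding_bound (C : R) := forall f, fock_space f ->
  (weighted_norm f <= C%:E * fock_norm f)%E.

Definition fock_carleson := exists C : R, embedding_bound C.

(* The infimum of the empty set is +oo: the embedding is then unbounded. *)
Definition embedding_norm : \bar R :=
  ereal_inf [set C%:E | C in [set C : R | 0 <= C /\ embedding_bound C]].

(* Compactness of the embedding: it is well defined, and the image of every
   bounded sequence has a subsequence that converges in the weighted L^p. *)
Definition vanishing_fock_carleson :=
  (forall f, fock_space f -> weighted_Lp f) /\
  forall f : nat -> R[i] -> R[i], (forall n, fock_space (f n)) ->
    (exists M : R, forall n, (fock_norm (f n) <= M%:E)%E) ->
    exists s : nat -> nat, {homo s : m n / (m < n)%N} /\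
    exists g, weighted_Lp g /\
      weighted_norm (fun z => f (s k) z - g z) @[k --> \oo] --> 0%E.

End CarlesonMeasures.

Definition berezin (t : R) (mu : {measure set R[i] -> \bar R}) w : \bar R :=
  (\int[mu]_z (normc (fock_kernel w z) `^ t
      * expR (- (alpha * t / 2) * normc z ^+ 2))%:E)%E.

End Fock.

Definition covering_sequence (r : R) (z : nat -> R[i]) :=
  \bigcup_k disc (z k) (r / 2) = setT /\
  trivIset setT (fun k => disc (z k) (r / 4)).

Definition l1_norm (a : nat -> \bar R) : \bar R := (\sum_(k <oo) `|a k|)%E.

(* U and V range over [0, +oo]; one is infinite iff the other is. *)
Definition bounded_ratio (C : R) (U V : \bar R) :=
  (C^-1%:E * V <= U)%E /\ (U <= C%:E * V)%E.

End Complex.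

Arguments complex_lebesgue R : clear implicits.

(* Main.v *)
From HB Require Import structures.
Require Import Defs.
From mathcomp Require Import all_boot all_order all_algebra.
From mathcomp Require Import complex.
From mathcomp Require Import all_classical all_reals all_analysis.
From mathcomp Require Import measurable_realfun ring lra.
Import Order.TTheory GRing.Theory Num.Theory.
Import numFieldNormedType.Exports ComplexField.Normc.
Local Open Scope classical_set_scope.
Local Open Scope ring_scope.
Local Open Scope complex_scope.
Set Implicit Arguments.
Unset Strict Implicit.
Unset Printing Implicit Defensive.

(** All the quantities of the statement are comparable with the total mass
    [mu setT], and all the conditions mean that it is finite.

    Averages and discrete sums. Since the discs [D(z_k, r/2)] cover the plane,
    [mu setT] is at most the sum of the [mu (D(z_k, r))]
    ([mass_le_covering]). Since the discs [D(z_k, r/4)] are disjoint and have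
    area at least [(r/4)^2], that sum is at most a constant times the integral
    of any function that dominates [mu (D(z_k, r))] on [D(z_k, r/4)]
    ([covering_le_integral]). This bounds the integral of [mu (D(., delta))]
    and that of the Berezin transform from below for every measure, without
    any measurability. For a finite measure, the bounds from above are
    Tonelli's theorem ([double_integral_le]), as the Berezin transform is the
    convolution of [mu] with a Gaussian ([berezinE]).

    The embedding, from above. If [mu] is finite, the embedding is bounded
    because the weighted modulus of [f] is at most its norm
    ([finite_embedding_bound]). It is compact because a bounded sequence of
    entire functions has a pointwise convergent subsequence ([montel]), to
    which dominated convergence applies. Montel's theorem rests on Cauchy's
    estimate for the derivative of an entire function [f]
    ([cauchy_estimate]), proved for functions that are only assumed to be
    complex differentiable everywhere. Goursat's bisection shows that the
    mean of [(f (z0 + exp z) - f z0) / exp z], an entire function of period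
    [2 pi i], over the segments [[s, s + 2 pi i]] does not depend on [s]; it
    tends to [f' z0] as [s] tends to [- oo].

    The embedding, from below. Theta series are used in place of random
    series of reproducing kernels. The weighted modulus of
    [exp (alpha/2 z^2 + 2 i alpha s z - alpha s^2)] is
    [exp (- alpha (Im z + s)^2)], so that the sum of these functions over a
    long arithmetic progression of values of [s] has bounded norm. If the
    step is large, such a sum is bounded below wherever [- Im z] is close to
    a term of the progression; with the progression shifted by half a step,
    this covers a strip ([theta_ge_strip]). Two test functions thus bound the
    mass of the strip, uniformly in its width
    ([mass_le_embedding_bound]). If the embedding is compact, the same sums
    are bounded in [L^p(mu)] along a subsequence ([vanishing_finite]). *)

(** The modulus of a complex number, as an element of the real field. *)
Local Notation nrm z := (normc z%C : Real.sort _).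

(** * Primitives of continuous functions *)

Section RealAnalysis.
Variable R : realType.

Lemma mvt_bound (F f : R -> R) (a b K : R) : a <= b ->
  (forall x, a <= x <= b -> is_derive x 1 F (f x)) ->
  (forall x, a <= x <= b -> `|f x| <= K) ->
  `|F b - F a| <= K * (b - a).
Proof.
move=> ab dF fK.
have [||c cab ->] := @MVT_segment R F f a b ab.
- by move=> x; rewrite in_itv/= => /andP[/ltW ax /ltW xb]; apply: dF; rewrite ax.
- apply: derivable_within_continuous => x; rewrite in_itv/= => xab.
  exact: (@ex_derive _ _ _ _ _ _ _ (dF x xab)).
rewrite normrM (ger0_norm (_ : 0 <= b - a)) ?subr_ge0//.
by rewrite ler_wpM2r ?subr_ge0// fK.
Qed.

Lemma antiderivative_uniq (F G f : R -> R) (a b : R) :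
  (forall x : R, is_derive x 1 F (f x)) -> (forall x : R, is_derive x 1 G (f x)) ->
  F b - F a = G b - G a.
Proof.
move=> dF dG.
wlog ab : a b / a <= b => [H|].
  have [|/ltW ba] := leP a b; first exact: H.
  by rewrite -opprB (H b a ba) opprB.
apply/eqP; rewrite -subr_eq0 -normr_le0.
have -> : F b - F a - (G b - G a) = (F \- G) b - (F \- G) a by rewrite /=; ring.
rewrite -[leRHS](mul0r (b - a)).
apply: (mvt_bound (f := fun x => f x - f x)) => // x xab.
by rewrite subrr normr0.
Qed.

(** The indefinite integrals from [- n] are primitives above [- n]; normalised
    at [0], they agree where they are defined, and they are glued. *)
Lemma antiderivative_exists (f : R -> R) : continuous f ->
  exists F : R -> R, forall x : R, is_derive x 1 F (f x).
Proof.
move=> cf.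
pose I (n : nat) (x : R) : R :=
  (\int[lebesgue_measure]_(t in [set` Interval (BLeft (- n%:R)) (BRight x)]) f t)%R.
have dI n (x : R) : - n%:R < x -> is_derive x 1 (I n) (f x).
  move=> nx.
  have [||||d dv] := @continuous_FTC1_closed R f (- n%:R) x (x + 1).
  - by rewrite ltrDl.
  - apply: continuous_compact_integrable; first exact: segment_compact.
    by apply: continuous_subspaceT => ?; exact: cf.
  - exact: nx.
  - exact: cf.
  by split; [exact: d|rewrite -derive1E; exact: dv].
pose k (x : R) := (Num.truncn `|x|).+1.
have kx (x : R) : `|x| < (k x)%:R by rewrite /k; exact: truncnS_gt.
pose F x := I (k x) x - I (k x) 0.
have FI n (x : R) : `|x| < n%:R -> F x = I n x - I n 0.
  move=> xn; rewrite /F.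
  have H m m' (a b : R) : (a <= b) -> - m%:R < a -> - m'%:R < a ->
      I m b - I m a = I m' b - I m' a.
    move=> ab ma m'a; apply/eqP; rewrite -subr_eq0 -normr_le0.
    have -> : I m b - I m a - (I m' b - I m' a)
      = (I m \- I m') b - (I m \- I m') a by rewrite /=; ring.
    rewrite -[leRHS](mul0r (b - a)).
    apply: (mvt_bound (f := fun x => f x - f x)) => // y /andP[ay yb].
      exact: (is_deriveB (dI _ _ (lt_le_trans ma ay))
                         (dI _ _ (lt_le_trans m'a ay))).
    by rewrite subrr normr0.
  have := kx x; rewrite ltr_norml => /andP[kx1 _].
  move: (xn); rewrite ltr_norml => /andP[nx1 _].
  have k0 : - (k x)%:R < 0 :> R by rewrite oppr_lt0 (le_lt_trans _ (kx x)).
  have n0 : - n%:R < 0 :> R by rewrite oppr_lt0 (le_lt_trans _ xn).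
  have [x0|/ltW x0] := leP 0 x; first exact: H.
  by rewrite -[LHS]opprB -[RHS]opprB (H _ n).
exists F => x.
have h : is_derive x 1 (fun y => I (k x) y - I (k x) 0) (f x).
  have := kx x; rewrite ltr_norml => /andP[kx1 _].
  rewrite -[f x]subr0.
  exact: (is_deriveB (dI _ _ kx1) (is_derive_cst (I (k x) 0) x 1)).
apply: near_eq_is_derive h.
have : \forall y \near x, `|y| < (k x)%:R.
  apply/nbhs_ballP; exists ((k x)%:R - `|x|); first by rewrite /= subr_gt0 kx.
  move=> y; rewrite -ball_normE /= distrC ltrBrDr; apply: le_lt_trans.
  by rewrite -{1}(subrK x y) ler_normD.
by apply: filterS => y yk; rewrite (FI (k x)).
Qed.

End RealAnalysis.

(** * Goursat's theorem on rectangles *)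

Section Goursat.
Variable R : realType.

Lemma is_derive_quadratic (c1 c2 x0 x : R) :
  is_derive x 1 (fun t : R => c1 * (t - x0) + c2 / 2 * (t - x0) ^+ 2)
    (c1 + c2 * (x - x0)).
Proof.
have d1 : is_derive x 1 (fun t : R => t - x0) 1.
  rewrite -[X in is_derive _ _ _ X]subr0.
  exact: (is_deriveB (is_derive_id x 1) (is_derive_cst x0 x 1)).
have d2 : is_derive x 1 (fun t : R => (t - x0) ^+ 2) (2 * (x - x0)).
  apply: (is_derive_eq (is_deriveM d1 d1)).
  by rewrite /GRing.scale /=; ring.
apply: (is_derive_eq (is_deriveD (is_deriveZ c1 d1) (is_deriveZ (c2 / 2) d2))).
by rewrite /GRing.scale /=; field.
Qed.

(** Comparison of the increment of a primitive with that of a quadratic polynomial,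
    when the integrand is close to an affine function. *)
Lemma primitive_affine_approx (F f : R -> R) (a b c1 c2 x0 K : R) : a <= b ->
  (forall x : R, is_derive x 1 F (f x)) ->
  (forall x, a <= x <= b -> `|f x - (c1 + c2 * (x - x0))| <= K) ->
  `|F b - F a - (c1 * (b - x0) + c2 / 2 * (b - x0) ^+ 2
     - (c1 * (a - x0) + c2 / 2 * (a - x0) ^+ 2))| <= K * (b - a).
Proof.
move=> ab dF fK.
set q := fun t : R => c1 * (t - x0) + c2 / 2 * (t - x0) ^+ 2.
have -> : F b - F a - (c1 * (b - x0) + c2 / 2 * (b - x0) ^+ 2
     - (c1 * (a - x0) + c2 / 2 * (a - x0) ^+ 2)) = (F \- q) b - (F \- q) a.
  by rewrite /q /=; ring.
apply: (@mvt_bound _ _ (fun x => f x - (c1 + c2 * (x - x0))) _ _ _ ab _ fK).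
by move=> x _; exact: (is_deriveB (dF x) (is_derive_quadratic c1 c2 x0 x)).
Qed.

Lemma nested_segments (u l : nat -> R) : (forall n, 0 <= l n) ->
  (forall n, u n <= u n.+1) -> (forall n, u n.+1 + l n.+1 <= u n + l n) ->
  exists x, forall n, u n <= x <= u n + l n.
Proof.
move=> l0 uS ulS.
have um m n : (m <= n)%N -> u m <= u n.
  move=> /subnK <-; elim: (n - m)%N => [|k IH]; first by rewrite add0n.
  by rewrite addSn; exact: le_trans IH (uS _).
have ulm m n : (m <= n)%N -> u n + l n <= u m + l m.
  move=> /subnK <-; elim: (n - m)%N => [|k IH]; first by rewrite add0n.
  by rewrite addSn; exact: le_trans (ulS _) IH.
have uul m n : u m <= u n + l n.
  have [mn|/ltnW nm] := leqP m n.
    by apply: (le_trans (um _ _ mn)); rewrite lerDl.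
  by apply: le_trans (ulm _ _ nm); rewrite lerDl.
exists (sup (range u)) => n; apply/andP; split.
- apply: ub_le_sup; last by exists n.
  by exists (u 0 + l 0) => _ [m _ <-]; exact: uul.
- apply: ge_sup; first by exists (u 0); exists 0.
  by move=> _ [m _ <-]; exact: uul.
Qed.

Variables (P Q X Y : R -> R -> R).

(** The circulation of [P dx + Q dy] around the rectangle with corners [(a, c)] and
    [(b, d)], where [X] and [Y] are primitives of [P] and [Q] along the axes. *)
Definition circ a b c d :=
  X b c - X a c + (Y b d - Y b c) - (X b d - X a d) - (Y a d - Y a c).

(** [P dx + Q dy] is closed at first order, at a point: the differential of [(P, Q)]
    there exists and is a symmetric matrix. *)
Definition closed_at (x0 y0 : R) := exists p1 p2 q2 : R,
  forall e : R, 0 < e -> exists2 d : R, 0 < d & forall x y : R,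
   `|x - x0| < d -> `|y - y0| < d ->
   `|P x y - (P x0 y0 + p1 * (x - x0) + p2 * (y - y0))|
      <= e * (`|x - x0| + `|y - y0|) /\
   `|Q x y - (Q x0 y0 + p2 * (x - x0) + q2 * (y - y0))|
      <= e * (`|x - x0| + `|y - y0|).

Hypothesis dX : forall x y : R, is_derive x 1 (X ^~ y) (P x y).
Hypothesis dY : forall x y : R, is_derive y 1 (Y x) (Q x y).

(** The affine parts of [P] and [Q] at a point derive from a quadratic polynomial,
    whose circulation vanishes. *)
Lemma circ_small (x0 y0 : R) (e : R) : closed_at x0 y0 -> 0 < e ->
  exists2 d : R, 0 < d & forall a b c d' s : R,
    a <= x0 <= b -> c <= y0 <= d' -> b - a + (d' - c) <= s -> s < d ->
    `|circ a b c d'| <= 4 * (e * s ^+ 2).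
Proof.
move=> [p1 [p2 [q2 H]]] e0; have [d d0 {}H] := H _ e0.
exists d => // a b c d' s /andP[ax xb] /andP[cy yd'] abs sd.
have bx x y : a <= x <= b -> c <= y <= d' ->
   `|P x y - (P x0 y0 + p2 * (y - y0) + p1 * (x - x0))| <= e * s /\
   `|Q x y - (Q x0 y0 + p2 * (x - x0) + q2 * (y - y0))| <= e * s.
  move=> /andP[ax' x'b] /andP[cy' y'd'].
  have h1 : `|x - x0| <= b - a by rewrite ler_norml; apply/andP; split; lra.
  have h2 : `|y - y0| <= d' - c by rewrite ler_norml; apply/andP; split; lra.
  have [||h3 h4] := H x y.
  - by apply: le_lt_trans h1 _; lra.
  - by apply: le_lt_trans h2 _; lra.
  have h5 : e * (`|x - x0| + `|y - y0|) <= e * s by rewrite (ler_wpM2l (ltW e0))//; lra.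
  split; last exact: le_trans h4 h5.
  by rewrite (addrAC _ (p2 * _)); exact: le_trans h3 h5.
have ab : a <= b by lra.
have cd : c <= d' by lra.
have s0 : 0 <= s by lra.
have es : e * s * (b - a) <= e * s ^+ 2.
  by rewrite expr2 mulrA (ler_wpM2l (mulr_ge0 (ltW e0) s0))//; lra.
have es' : e * s * (d' - c) <= e * s ^+ 2.
  by rewrite expr2 mulrA (ler_wpM2l (mulr_ge0 (ltW e0) s0))//; lra.
have E1 y : c <= y <= d' -> _ := fun hy => @primitive_affine_approx _ _ a b
  (P x0 y0 + p2 * (y - y0)) p1 x0 (e * s) ab (dX ^~ y) (fun x hx => (bx x y hx hy).1).
have E2 x : a <= x <= b -> _ := fun hx => @primitive_affine_approx _ _ c d'
  (Q x0 y0 + p2 * (x - x0)) q2 y0 (e * s) cd (dY x) (fun y hy => (bx x y hx hy).2).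
have cc : c <= c <= d' by rewrite lexx.
have dd : c <= d' <= d' by rewrite lexx cd.
have aa : a <= a <= b by rewrite lexx.
have bb : a <= b <= b by rewrite lexx ab.
have F1 := le_trans (E1 _ cc) es.
have F2 := le_trans (E1 _ dd) es.
have F3 := le_trans (E2 _ aa) es'.
have F4 := le_trans (E2 _ bb) es'.
move: F1 F2 F3 F4; rewrite /circ !ler_norml.
move=> /andP[? ?] /andP[? ?] /andP[? ?] /andP[? ?].
by apply/andP; split; lra.
Qed.

(** Goursat: a form that is closed at first order at every point has no circulation,
    although its coefficients need not be continuously differentiable. *)
Theorem goursat (a b c d : R) : a <= b -> c <= d ->
  (forall x y, closed_at x y) -> circ a b c d = 0.
Proof.
move=> ab cd cl; apply/eqP; apply: contraT => nz.
set K := `|circ a b c d|; have K0 : 0 < K by rewrite normr_gt0.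
pose l1 n := (b - a) / 2 ^+ n; pose l2 n := (d - c) / 2 ^+ n.
have l10 n : 0 <= l1 n by rewrite divr_ge0 ?subr_ge0// exprn_ge0.
have l20 n : 0 <= l2 n by rewrite divr_ge0 ?subr_ge0// exprn_ge0.
have l1S n : l1 n = l1 n.+1 + l1 n.+1.
  by rewrite /l1 exprS; field; rewrite expf_neq0.
have l2S n : l2 n = l2 n.+1 + l2 n.+1.
  by rewrite /l2 exprS; field; rewrite expf_neq0.
pose C n (w : R * R) := circ w.1 (w.1 + l1 n) w.2 (w.2 + l2 n).
pose good n w := K / 4 ^+ n <= `|C n w|.
(* Bisection: some quarter of a rectangle carries at least a quarter of the
   circulation. *)
have /boolp.choice[step stepP] : forall nw : nat * (R * R), exists w' : R * R,
    good nw.1 nw.2 -> [/\ good nw.1.+1 w',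
      nw.2.1 <= w'.1 <= nw.2.1 + l1 nw.1.+1 &
      nw.2.2 <= w'.2 <= nw.2.2 + l2 nw.1.+1].
  move=> [n [u v]] /=.
  have [gw|] := pselect (good n (u, v)); last by exists (u, v).
  pose w00 := (u, v); pose w10 := (u + l1 n.+1, v).
  pose w01 := (u, v + l2 n.+1); pose w11 := (u + l1 n.+1, v + l2 n.+1).
  have CE : C n (u, v) = C n.+1 w00 + C n.+1 w10 + C n.+1 w01 + C n.+1 w11.
    by rewrite /C /circ /= (l1S n) (l2S n) !addrA; ring.
  suff [w' [gw' h1 h2]] : exists w', [/\ good n.+1 w',
      u <= w'.1 <= u + l1 n.+1 & v <= w'.2 <= v + l2 n.+1] by exists w'.
  have [g|g0] := pselect (good n.+1 w00).
    by exists w00; rewrite /w00 /= !lexx !lerDl l10 l20.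
  have [g|g1] := pselect (good n.+1 w10).
    by exists w10; rewrite /w10 /= !lexx !lerDl l10 l20.
  have [g|g2] := pselect (good n.+1 w01).
    by exists w01; rewrite /w01 /= !lexx !lerDl l10 l20.
  have [g|g3] := pselect (good n.+1 w11).
    by exists w11; rewrite /w11 /= !lexx !lerDl l10 l20.
  exfalso; move: gw g0 g1 g2 g3; rewrite /good CE.
  move=> gw /negP + /negP + /negP + /negP; rewrite -!ltNge => g0 g1 g2 g3.
  have K4 : K / 4 ^+ n = 4 * (K / 4 ^+ n.+1).
    by rewrite exprS; field; rewrite expf_neq0.
  have := ler_normD (C n.+1 w00 + C n.+1 w10 + C n.+1 w01) (C n.+1 w11).
  have := ler_normD (C n.+1 w00 + C n.+1 w10) (C n.+1 w01).
  have := ler_normD (C n.+1 w00) (C n.+1 w10).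
  by move: gw; rewrite K4; lra.
pose w n := iteri n (fun n w => step (n, w)) (a, c).
have gw n : good n (w n).
  elim: n => [|n IH]; last by have [] := stepP (n, w n) IH.
  rewrite /good /C /w /l1 /l2 /= expr0 !divr1.
  by rewrite (addrC a) (addrC c) !subrK.
have wS n := stepP (n, w n) (gw n).
have [x0 hx] : exists x, forall n, (w n).1 <= x <= (w n).1 + l1 n.
  apply: nested_segments => // n; have [_ /= /andP[h1 h2] _] := wS n; first exact: h1.
  by move: h2; rewrite (l1S n) /w /=; lra.
have [y0 hy] : exists x, forall n, (w n).2 <= x <= (w n).2 + l2 n.
  apply: nested_segments => // n; have [_ _ /= /andP[h1 h2]] := wS n; first exact: h1.
  by move: h2; rewrite (l2S n) /w /=; lra.
pose L := b - a + (d - c).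
have L0 : 0 <= L by rewrite /L; lra.
have L1 : 0 < L ^+ 2 + 1 by rewrite ltr_wpDl// sqr_ge0.
(* This accuracy makes the bound of [circ_small], which is [4 e L ^ 2 / 4 ^ n] for
   the [n]-th rectangle, smaller than [K / 4 ^ n]. *)
have e0 : 0 < K / (8 * (L ^+ 2 + 1)) by rewrite divr_gt0// mulr_gt0.
have [r r0 H] := circ_small (cl x0 y0) e0.
have [n nr] : exists n, L / 2 ^+ n < r.
  exists (Num.truncn (L / r)).+1.
  rewrite ltr_pdivrMr ?exprn_gt0// mulrC -ltr_pdivrMr//.
  apply: lt_trans (truncnS_gt _) _.
  by rewrite -natrX ltr_nat ltn_expl.
have := H _ _ _ _ (L / 2 ^+ n) (hx n) (hy n).
rewrite [_ - _ + _](_ : _ = L / 2 ^+ n); last first.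
  by rewrite /L /l1 /l2 mulrDl; ring.
move=> /(_ (lexx _) nr); apply: contraLR => _; rewrite -ltNge.
apply: lt_le_trans (gw n).
have -> : 4 * (K / (8 * (L ^+ 2 + 1)) * (L / 2 ^+ n) ^+ 2)
    = K / 4 ^+ n * (L ^+ 2 / (2 * (L ^+ 2 + 1))).
  have -> : 4 ^+ n = 2 ^+ n * 2 ^+ n :> R by rewrite -exprMn; congr (_ ^+ _); ring.
  by field; rewrite expf_neq0//= gt_eqF.
have K4 : 0 < K / 4 ^+ n by rewrite divr_gt0// exprn_gt0.
rewrite gtr_pMr// ltr_pdivrMr ?mulr_gt0//.
by have := sqr_ge0 L; lra.
Qed.

End Goursat.

(** * Modulus, complex derivative and exponential *)

Section ComplexNorm.
Variable R : realType.
Implicit Types (z w : R[i]).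

Lemma normE z : `|z| = (nrm z)%:C.
Proof. by case: z => a b; rewrite normc_def. Qed.

Lemma normcE2 z : nrm z = Num.sqrt (complex.Re z ^+ 2 + complex.Im z ^+ 2).
Proof. by case: z. Qed.

Lemma normc_ge0 z : 0 <= nrm z.
Proof. by rewrite normcE2 sqrtr_ge0. Qed.

Lemma normc_sqr z : nrm z ^+ 2 = complex.Re z ^+ 2 + complex.Im z ^+ 2.
Proof. by rewrite normcE2 sqr_sqrtr// addr_ge0// sqr_ge0. Qed.

Lemma normc_real (x : R) : nrm x%:C = `|x|.
Proof. by rewrite normcE2 /= expr0n addr0 sqrtr_sqr. Qed.

Lemma normc_Re z : `|complex.Re z| <= nrm z.
Proof.
by rewrite normcE2 -sqrtr_sqr ler_sqrt ?addr_ge0 ?sqr_ge0// lerDl sqr_ge0.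
Qed.

Lemma normc_Im z : `|complex.Im z| <= nrm z.
Proof.
by rewrite normcE2 -sqrtr_sqr ler_sqrt ?addr_ge0 ?sqr_ge0// lerDr sqr_ge0.
Qed.

Lemma normc_le z : nrm z <= `|complex.Re z| + `|complex.Im z|.
Proof.
rewrite -ler_sqr ?nnegrE ?normc_ge0 ?addr_ge0// normc_sqr sqrrD.
rewrite !real_normK ?num_real// addrAC lerDl.
by rewrite mulrn_wge0// mulr_ge0.
Qed.

Lemma normc_eq0P z : nrm z = 0 -> z = 0.
Proof. exact: eq0_normc. Qed.

Lemma normc_gt0 z : z != 0 -> 0 < nrm z.
Proof.
move=> z0; rewrite lt_neqAle normc_ge0 andbT eq_sym.
by apply: contra z0 => /eqP/normc_eq0P ->.
Qed.

Lemma normcB z w : nrm (z - w) = nrm (w - z).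
Proof. by rewrite -normcN opprB. Qed.

Lemma ler_normcB_dist z w : nrm z - nrm w <= nrm (z - w).
Proof. by rewrite lerBlDr; apply: le_trans (le_normcD _ _); rewrite subrK. Qed.

Lemma complex_eq z w : complex.Re z = complex.Re w -> complex.Im z = complex.Im w -> z = w.
Proof. by case: z w => [? ?] [? ?] /= -> ->. Qed.

Lemma gt0_complexP (e : R[i]) : 0 < e -> exists2 x : R, 0 < x & e = x%:C.
Proof.
case: e => a b; rewrite ltcE /= => /andP[/eqP -> a0]; by exists a.
Qed.

Lemma discE z (r : R) : disc z r = [set w | nrm (z - w) < r].
Proof.
by apply/seteqP; split => w; rewrite /disc -ball_normE /= normE ltcR.
Qed.

End ComplexNorm.

Section ComplexDerivative.
Variable R : realType.
Implicit Types (f g : R[i] -> R[i]) (z w d : R[i]).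

(** [f] has complex derivative [d] at [z], in terms of the real-valued modulus. *)
Definition has_cderiv f z d := forall e : R, 0 < e -> exists2 r : R, 0 < r &
  forall h, nrm h < r -> nrm (f (z + h) - f z - d * h) <= e * nrm h.

Lemma derivable_has_cderiv f z : derivable f z 1 -> exists d, has_cderiv f z d.
Proof.
move=> /cvg_ex[d /cvgrPdist_le /= H]; exists d => e e0.
have /H : 0 < e%:C :> R[i] by rewrite ltcR.
rewrite /nbhs /= /dnbhs /within /= => -[r r0 {}H].
have [r' r'0 rE] := gt0_complexP r0.
exists r' => // h hr; have [->|h0] := eqVneq h 0.
  by rewrite mulr0 normc0 mulr0 addr0 subrr subr0 normc0.
have /= := H h _ h0.
rewrite sub0r normrN normE rE ltcR => /(_ hr).
rewrite normE lecR [h%:A]mulr1 (addrC h) => He.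
have -> : f (z + h) - f z - d * h = - (h * (d - h^-1 * (f (z + h) - f z))).
  by rewrite mulrBr mulVKf//; ring.
by rewrite normcN normcM mulrC ler_wpM2r ?normc_ge0.
Qed.

Lemma has_cderiv_derivable f z d : has_cderiv f z d -> derivable f z 1.
Proof.
move=> H; apply/cvg_ex; exists d; apply/cvgrPdist_le => /= e /gt0_complexP[e' e0 ->].
have [r r0 {}H] := H _ e0.
rewrite /nbhs /= /dnbhs /within /=; exists r%:C; first by rewrite /= ltcR.
move=> h /=; rewrite sub0r normrN normE ltcR => hr h0.
rewrite normE lecR [h%:A]mulr1 (addrC h).
have -> : d - h^-1 * (f (z + h) - f z) = - (h^-1 * (f (z + h) - f z - d * h)).
  by field.
rewrite normcN normcM normcV mulrC ler_pdivrMr ?normc_gt0//.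
exact: H.
Qed.

Lemma has_cderiv_continuity f z d : has_cderiv f z d -> forall e : R, 0 < e ->
  exists2 r : R, 0 < r & forall h, nrm h < r -> nrm (f (z + h) - f z) <= e.
Proof.
move=> H e e0; have [r r0 {}H] := H _ ltr01.
have d0 : 0 < nrm d + 1 by rewrite ltr_wpDl ?normc_ge0.
exists (Num.min r (e / (nrm d + 1))); first by rewrite lt_min r0 divr_gt0.
move=> h; rewrite lt_min => /andP[hr]; rewrite ltr_pdivlMr// => he.
rewrite -(subrK (d * h) (f _ - f _)); apply: le_trans (le_normcD _ _) _.
rewrite normcM; have := H _ hr; rewrite mul1r => Hh; nra.
Qed.

(** The counterpart of [has_cderiv] for a function of a real variable. *)
Lemma is_derive_approx (f : R -> R) (a d : R) : is_derive a 1 f d ->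
  forall e : R, 0 < e -> exists2 r : R, 0 < r &
    forall h : R, `|h| < r -> `|f (a + h) - f a - d * h| <= e * `|h|.
Proof.
move=> [/cvg_ex[l fl] dv] e e0.
have {}dv : l = d by rewrite -dv; apply/esym/cvg_lim => //.
rewrite {}dv in fl; move/cvgrPdist_le : fl => /(_ _ e0).
rewrite /nbhs /= /dnbhs /within /= => -[r r0 H].
exists r => // h hr; have [->|h0] := eqVneq h 0.
  by rewrite !mulr0 normr0 mulr0 addr0 subrr subr0 normr0.
have /= := H h _ h0.
rewrite sub0r normrN => /(_ hr); rewrite [h%:A]mulr1 (addrC h) => He.
have -> : f (a + h) - f a - d * h = - (h * (d - h^-1 * (f (a + h) - f a))).
  by rewrite mulrBr mulVKf//; ring.
by rewrite normrN normrM mulrC ler_wpM2r.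
Qed.

Lemma cexpD z w : cexp (z + w) = cexp z * cexp w.
Proof.
case: z w => [a b] [c d]; rewrite /cexp /= expRD cosD sinD.
by apply: complex_eq => /=; ring.
Qed.

Lemma normc_cexp z : nrm (cexp z) = expR (complex.Re z).
Proof.
rewrite /cexp normcM normc_real ger0_norm ?expR_ge0//.
by rewrite normcE2 /= cos2Dsin2 sqrtr1 mulr1.
Qed.

Lemma cexp0 : cexp 0 = 1 :> R[i].
Proof. by rewrite /cexp /= expR0 cos0 sin0 mul1r. Qed.

Lemma cexp_cderiv0 : has_cderiv (@cexp R) 0 1.
Proof.
move=> e e0.
(* The errors on [expR], [cos] and [sin] add up to at most [9 e' |h|]. *)
have [e' [e'0 e'e e'1]] : exists e' : R, [/\ 0 < e', e' <= e / 12 & e' <= 1].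
  exists (Num.min (e / 12) 1); rewrite lt_min ltr01 divr_gt0//.
  by rewrite !ge_min !lexx orbT.
have [r1 r10 H1] := is_derive_approx (is_derive_expR (0 : R)) e'0.
have [r2 r20 H2] := is_derive_approx (is_derive_cos (0 : R)) e'0.
have [r3 r30 H3] := is_derive_approx (is_derive_sin (0 : R)) e'0.
exists (Num.min (Num.min r1 (Num.min r2 r3)) e').
  by rewrite !lt_min r10 r20 r30 e'0.
case=> x y; set N := nrm _.
rewrite !lt_min add0r cexp0 mul1r => /andP[/andP[h1 /andP[h2 h3]] he].
have xn : `|x| <= N := normc_Re (x +i* y).
have yn : `|y| <= N := normc_Im (x +i* y).
have N0 : 0 <= N := normc_ge0 _.
move: N xn yn N0 h1 h2 h3 he => N xn yn N0 h1 h2 h3 he.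
have {H1} := H1 x (le_lt_trans xn h1).
have {H2} := H2 y (le_lt_trans yn h2).
have {H3} := H3 y (le_lt_trans yn h3).
rewrite !add0r cos0 sin0 expR0 oppr0 mul0r !subr0 ?addr0 !mul1r.
set C := cos y; set S := sin y; set E := expR x => HS HC HE.
apply: le_trans (normc_le _) _.
rewrite /cexp /= -/C -/S -/E !mul0r !subr0 !addr0.
have HS1 : `|S - y| <= e' * N by apply: le_trans HS _; rewrite (ler_wpM2l (ltW e'0)).
have HC1 : `|C - 1| <= e' * N by apply: le_trans HC _; rewrite (ler_wpM2l (ltW e'0)).
have HE1 : `|E - 1 - x| <= e' * N by apply: le_trans HE _; rewrite (ler_wpM2l (ltW e'0)).
have EB : `|E - 1| <= 2 * N.
  rewrite -(subrK x (E - 1)); apply: le_trans (ler_normD _ _) _; nra.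
have C1 : `|C| <= 1 by rewrite ler_norml cos_geN1 cos_le1.
have -> : E * C - 1 - x = (E - 1 - x) + E * (C - 1) by ring.
have -> : E * S - y = (E - 1) * y + E * (S - y) by ring.
have E3 : `|E| <= 3.
  rewrite -(subrK 1 E); apply: le_trans (ler_normD _ _) _; rewrite normr1; lra.
have T1 : `|E * (C - 1)| <= 3 * (e' * N) by rewrite normrM ler_pM.
have T2 : `|E * (S - y)| <= 3 * (e' * N) by rewrite normrM ler_pM.
have T3 : `|(E - 1) * y| <= 2 * N * e'.
  by rewrite normrM ler_pM// ltW// (le_lt_trans yn).
have F1 := ler_normD (E - 1 - x) (E * (C - 1)).
have F2 := ler_normD ((E - 1) * y) (E * (S - y)).
nra.
Qed.

Lemma derivable_cexp z : derivable (@cexp R) z 1.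
Proof.
apply: (@has_cderiv_derivable _ _ (cexp z)) => e e0.
have E0 : 0 < expR (complex.Re z) by exact: expR_gt0.
have [r r0 H] := cexp_cderiv0 (divr_gt0 e0 E0); exists r => // h /H.
rewrite add0r cexp0 mul1r => Hh.
have -> : cexp (z + h) - cexp z - cexp z * h = cexp z * (cexp h - 1 - h).
  by rewrite cexpD; ring.
rewrite normcM normc_cexp; apply: le_trans (ler_wpM2l (ltW E0) Hh) _.
by rewrite mulrA (mulrC _ (e / _)) divfK// gt_eqF.
Qed.

(** The operations on complex derivable functions, for the topology of [R[i]]. *)
Lemma derivable_compC f g z : derivable f (g z) 1 -> derivable g z 1 ->
  derivable (f \o g) z 1.
Proof.
move=> /derivable1_diffP df /derivable1_diffP dg.
by apply/derivable1_diffP; exact: (differentiable_comp dg df).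
Qed.

Lemma derivable_mulC f g z : derivable f z 1 -> derivable g z 1 ->
  derivable (fun w => f w * g w) z 1.
Proof. by move=> df dg; exact: (derivableM df dg). Qed.

Lemma derivable_addC f g z : derivable f z 1 -> derivable g z 1 ->
  derivable (fun w => f w + g w) z 1.
Proof. by move=> df dg; exact: (derivableD df dg). Qed.

Lemma derivable_cstC (c : R[i]) z : derivable (fun _ : R[i] => c) z 1.
Proof. exact: derivable_cst. Qed.

Lemma derivable_idC z : derivable (fun w : R[i] => w) z 1.
Proof. exact: derivable_id. Qed.

Lemma derivable_sumC n (f : 'I_n -> R[i] -> R[i]) z :
  (forall i, derivable (f i) z 1) -> derivable (fun w => \sum_(i < n) f i w) z 1.
Proof.
elim: n f => [|n IH] f df.
  under eq_fun do rewrite big_ord0; exact: derivable_cstC.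
under eq_fun do rewrite big_ord_recl.
by apply: derivable_addC; [exact: df|apply: IH => i; exact: df].
Qed.

Lemma entire_continuous f : entire f -> continuous f.
Proof.
by move=> ef z; apply: differentiable_continuous; apply/derivable1_diffP; exact: ef.
Qed.

End ComplexDerivative.

(** * Cauchy's estimate *)

Section CauchyEstimate.
Variable R : realType.
Implicit Types (f F : R[i] -> R[i]) (z w d : R[i]).

Lemma complex_line (s t s' t' : R) : s' +i* t' = (s +i* t) + ((s' - s) +i* (t' - t)).
Proof. by apply: complex_eq => /=; ring. Qed.

Lemma continuous_eps (u : R -> R) :
  (forall x e : R, 0 < e -> exists2 r : R, 0 < r &
     forall y, `|y - x| < r -> `|u y - u x| <= e) -> continuous u.
Proof.
move=> H x; apply/cvgrPdist_le => /= e /(H x)[r r0 {}H].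
apply/nbhs_ballP; exists r => // y xy; rewrite distrC; apply: H.
by rewrite distrC.
Qed.

Lemma entire_continuous_lines F : entire F ->
  [/\ forall t : R, continuous (fun s : R => complex.Re (F (s +i* t))),
      forall t : R, continuous (fun s : R => complex.Im (F (s +i* t))) &
      forall s : R, continuous (fun t : R => complex.Re (F (s +i* t)))].
Proof.
move=> eF.
have H z (e : R) : 0 < e -> exists2 r : R, 0 < r &
    forall h, nrm h < r -> nrm (F (z + h) - F z) <= e.
  by have [d /has_cderiv_continuity] := derivable_has_cderiv (eF z); apply.
split=> a; apply: continuous_eps => x e e0.
- have [r r0 {}H] := H (x +i* a) e e0; exists r => // y yr.
  rewrite (complex_line x a y a) subrr.
  have /H : nrm ((y - x) +i* 0) < r by rewrite (normc_real (y - x)).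
  apply: le_trans; apply: le_trans (normc_Re _).
  by rewrite raddfB.
- have [r r0 {}H] := H (x +i* a) e e0; exists r => // y yr.
  rewrite (complex_line x a y a) subrr.
  have /H : nrm ((y - x) +i* 0) < r by rewrite (normc_real (y - x)).
  apply: le_trans; apply: le_trans (normc_Im _).
  by rewrite raddfB.
- have [r r0 {}H] := H (a +i* x) e e0; exists r => // y yr.
  rewrite (complex_line a x a y) subrr.
  have /H : nrm (0 +i* (y - x)) < r.
    by rewrite normcE2 /= expr0n add0r sqrtr_sqr.
  apply: le_trans; apply: le_trans (normc_Re _).
  by rewrite raddfB.
Qed.

(** Cauchy--Riemann: the real part of [- i F dz] is closed. *)
Lemma entire_closed_at F (x y : R) : entire F ->
  closed_at (fun s t => complex.Im (F (s +i* t)))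
            (fun s t => complex.Re (F (s +i* t))) x y.
Proof.
move=> eF; have [d H] := derivable_has_cderiv (eF (x +i* y)).
exists (complex.Im d), (complex.Re d), (- complex.Im d) => e e0.
have [r r0 {}H] := H _ e0; exists (r / 2); first by rewrite divr_gt0.
move=> s t sx ty; rewrite (complex_line x y s t).
set h := (s - x) +i* (t - y).
have hn : nrm h <= `|s - x| + `|t - y| by exact: normc_le.
have /H {}H : nrm h < r by apply: le_lt_trans hn _; lra.
have {}H : nrm (F (x +i* y + h) - F (x +i* y) - d * h) <= e * (`|s - x| + `|t - y|).
  by apply: le_trans H _; rewrite (ler_wpM2l (ltW e0)).
have E (a b c : R[i]) : complex.Im (a - b - c) = complex.Im a - complex.Im b - complex.Im c /\
   complex.Re (a - b - c) = complex.Re a - complex.Re b - complex.Re c.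
  by rewrite !raddfB.
split; apply: le_trans H.
- apply: le_trans (normc_Im _); rewrite (E _ _ _).1.
  rewrite le_eqVlt; apply/orP; left; apply/eqP; congr (`| _ |).
  by rewrite /h; case: (d) => d1 d2 /=; ring.
- apply: le_trans (normc_Re _); rewrite (E _ _ _).2.
  rewrite le_eqVlt; apply/orP; left; apply/eqP; congr (`| _ |).
  by rewrite /h; case: (d) => d1 d2 /=; ring.
Qed.

(** An entire function [F] of period [2 pi i] has the same mean on all segments
    [[s, s + 2 pi i]]: this is the mean value property of [f], if
    [F z = f (exp z)]. Hence the limit [c] of the real part of [F] at [- oo] is
    bounded by the values of that real part on any one vertical line. *)
Lemma periodic_limit_bound F (c K s0 : R) : entire F ->
  (forall s t : R, F (s +i* (t + 2 * pi)) = F (s +i* t)) ->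
  (forall e : R, 0 < e -> exists S : R, forall s t : R, s <= S ->
     `|complex.Re (F (s +i* t)) - c| <= e) ->
  (forall t : R, `|complex.Re (F (s0 +i* t))| <= K) -> `|c| <= K.
Proof.
move=> eF per lim bK.
have [cRe cIm cRe'] := entire_continuous_lines eF.
have /boolp.choice[X dX] := fun t => antiderivative_exists (cIm t).
have /boolp.choice[Y dY] := fun s => antiderivative_exists (cRe' s).
have pi0 : 0 < 2 * pi :> R by rewrite mulr_gt0// pi_gt0.
have mean s : s <= s0 -> Y s (2 * pi) - Y s 0 = Y s0 (2 * pi) - Y s0 0.
  move=> ss0.
  have := goursat (X := fun s t => X t s) (fun x y => dX y x) dY ss0 (ltW pi0)
    (fun x y => entire_closed_at x y eF).
  rewrite /circ => /eqP.
  have -> : X (2 * pi) s0 - X (2 * pi) s = X 0 s0 - X 0 s.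
    apply: (antiderivative_uniq (f := fun u => complex.Im (F (u +i* 0)))) => // x.
    by rewrite -per add0r.
  by move=> /eqP; lra.
have mvt s k e : (forall t : R, `|complex.Re (F (s +i* t)) - k| <= e) ->
    `|Y s (2 * pi) - Y s 0 - 2 * pi * k| <= e * (2 * pi).
  move=> H; have := @primitive_affine_approx _ (Y s)
    (fun t => complex.Re (F (s +i* t))) 0 (2 * pi) k 0 0 e (ltW pi0) (dY s).
  rewrite !subr0 mul0r !mul0r !mulr0 !addr0 !subr0 (mulrC k); apply.
  by move=> t _; rewrite mul0r addr0.
apply/ler_addgt0Pr => e e0; have [S HS] := lim _ e0.
pose s := Num.min S s0.
have ss0 : s <= s0 by rewrite ge_min lexx orbT.
have sS : s <= S by rewrite ge_min lexx.
have H1 := mvt s c e (fun t => HS s t sS).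
have H2 := mvt s0 0 K (fun t => _).
move: H2; rewrite mulr0 subr0 -(mean s ss0) => H2.
have {}H2 := H2 (fun t => ltac:(by rewrite subr0; exact: bK)).
rewrite -(ler_pM2r pi0) -[X in `|c| * X](ger0_norm (ltW pi0)) -normrM.
set I := Y s _ - _ in H1 H2.
have -> : c * (2 * pi) = I - (I - 2 * pi * c) by ring.
by apply: le_trans (ler_normB _ _) _; rewrite [leRHS]mulrDl; exact: lerD.
Qed.

(** Cauchy's estimate, with the constant [4]: the real and the imaginary part of
    [(f (z0 + h) - f z0) / h] are each bounded by [2 M / r] on the circle. *)
Lemma cauchy_estimate f z0 d (r M : R) : entire f -> has_cderiv f z0 d ->
  0 < r -> (forall h, nrm h <= r -> nrm (f (z0 + h)) <= M) ->
  nrm d <= 4 * M / r.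
Proof.
move=> ef fd r0 fM.
(* [cexp (- z)] is used as the inverse of [cexp z], so that [G] is visibly entire. *)
pose G z := (f (z0 + cexp z) + (- f z0)) * cexp (- 1 * z).
have cexpN z : cexp z * cexp (- 1 * z) = 1 by rewrite -cexpD mulN1r subrr cexp0.
have eG : entire G.
  move=> z; apply: derivable_mulC.
    apply: derivable_addC; last exact: derivable_cstC.
    apply: (derivable_compC (f := f) (g := fun z => z0 + cexp z)); first exact: ef.
    by apply: derivable_addC; [exact: derivable_cstC|exact: derivable_cexp].
  apply: (derivable_compC (f := @cexp R) (g := fun z => -1 * z)).
    exact: derivable_cexp.
  by apply: derivable_mulC; [exact: derivable_cstC|exact: derivable_idC].
have Gd (e : R) : 0 < e -> exists S : R, forall s t : R, s <= S ->
    nrm (G (s +i* t) - d) <= e.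
  move=> e0; have [p p0 H] := fd _ e0; exists (ln (p / 2)) => s t sS.
  set z := s +i* t.
  have -> : G z - d = (f (z0 + cexp z) - f z0 - d * cexp z) * cexp (- 1 * z).
    by rewrite [RHS]mulrBl -mulrA cexpN mulr1.
  have zp : nrm (cexp z) < p.
    rewrite normc_cexp /=; apply: (@le_lt_trans _ _ (p / 2)); last by lra.
    by rewrite -[leRHS]lnK ?posrE ?divr_gt0// ler_expR.
  rewrite normcM; apply: le_trans (ler_wpM2r (normc_ge0 _) (H _ zp)) _.
  by rewrite -mulrA -normcM cexpN normc1 mulr1.
have Gper (s t : R) : G (s +i* (t + 2 * pi)) = G (s +i* t).
  have E (a b : R) : @cexp R (a +i* (b + 2 * pi)) = cexp (a +i* b).
    by rewrite /cexp /= mulr_natl cosD2pi sinD2pi.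
  have E' (a b : R) : @cexp R (-1 * (a +i* (b + 2 * pi))) = cexp (-1 * (a +i* b)).
    rewrite -[in RHS](_ : -1 * (a +i* (b + 2 * pi)) + (0 +i* (0 + 2 * pi)) = -1 * (a +i* b)).
      by rewrite cexpD E cexp0 mulr1.
    by apply: complex_eq => /=; ring.
  by rewrite /G E E'.
have Gr t : nrm (G (ln r +i* t)) <= 2 * M / r.
  rewrite /G normcM normc_cexp /=.
  rewrite oppr0 mul0r subr0 mulN1r expRN lnK ?posrE// ler_pM2r ?invr_gt0//.
  apply: le_trans (le_normcD _ _) _; rewrite normcN.
  have h1 : nrm (f (z0 + cexp (ln r +i* t))) <= M.
    by apply: fM; rewrite normc_cexp /= lnK.
  have h2 : nrm (f z0) <= M.
    by rewrite -[z0]addr0; apply: fM; rewrite normc0 ltW.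
  by lra.
apply: le_trans (normc_le _) _.
have -> : 4 * M / r = 2 * M / r + 2 * M / r by field; rewrite gt_eqF.
apply: lerD.
- apply: (@periodic_limit_bound G _ _ (ln r) eG Gper) => [e /Gd[S HS]|t].
    exists S => s t /HS - /(_ t); apply: le_trans; apply: le_trans (normc_Re _).
    by rewrite raddfB.
  exact: le_trans (normc_Re _) (Gr t).
- (* The imaginary part of [G] is the real part of [- i G]. *)
  pose G' z := (0 -i* 1) * G z.
  have ReG' z : complex.Re (G' z) = complex.Im (G z).
    by rewrite /G'; case: (G z) => a b /=; ring.
  apply: (@periodic_limit_bound G' _ _ (ln r)) => [z|s t|e /Gd[S HS]|t].
  + by apply: derivable_mulC; [exact: derivable_cstC|exact: eG].
  + by rewrite /G' Gper.
  + exists S => s t /HS - /(_ t); apply: le_trans; apply: le_trans (normc_Im _).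
    by rewrite ReG' raddfB.
  + by rewrite ReG'; exact: le_trans (normc_Im _) (Gr t).
Qed.

End CauchyEstimate.

(** * Montel's theorem *)

Section NormalFamilies.
Variable R : realType.
Implicit Types (f g : R[i] -> R[i]) (z w d v : R[i]).

(** The converse of [is_derive_approx]. *)
Lemma approx_is_derive (f : R -> R) (a d : R) :
  (forall e : R, 0 < e -> exists2 r : R, 0 < r &
    forall h : R, `|h| < r -> `|f (a + h) - f a - d * h| <= e * `|h|) ->
  is_derive a 1 f d.
Proof.
move=> H.
have fd : h^-1 *: ((f \o shift a) (h *: (1 : R)) - f a) @[h --> 0^'] --> d.
  apply/cvgrPdist_le => /= e /H[r r0 {}H].
  rewrite /nbhs /= /dnbhs /within /=; exists r => // h /=.
  rewrite sub0r normrN => hr h0; rewrite [h%:A]mulr1 (addrC h).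
  have -> : d - h^-1 *: (f (a + h) - f a) = - (h^-1 * (f (a + h) - f a - d * h)).
    by rewrite /GRing.scale /=; field.
  rewrite normrN normrM normfV mulrC ler_pdivrMr ?normr_gt0//.
  exact: H.
apply: DeriveDef; first by apply/cvg_ex; exists d.
exact/cvg_lim.
Qed.

Lemma is_derive_segment f w v (t : R) (d : R[i]) : has_cderiv f (w + t%:C * v) d ->
  is_derive t 1 (fun t : R => complex.Re (f (w + t%:C * v))) (complex.Re (d * v)) /\
  is_derive t 1 (fun t : R => complex.Im (f (w + t%:C * v))) (complex.Im (d * v)).
Proof.
move=> H.
have {}H (e : R) : 0 < e -> exists2 r : R, 0 < r & forall h : R, `|h| < r ->
    nrm (f (w + (t + h)%:C * v) - f (w + t%:C * v) - (d * v) * h%:C) <= e * `|h|.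
  move=> e0; have v1 : 0 < nrm v + 1 by rewrite ltr_wpDl ?normc_ge0.
  have [r r0 {}H] := H _ (divr_gt0 e0 v1).
  exists (r / (nrm v + 1)) => [|h]; first exact: divr_gt0.
  rewrite ltr_pdivlMr// => hr.
  have nh : nrm (h%:C * v) = `|h| * nrm v by rewrite normcM normc_real.
  have /H : nrm (h%:C * v) < r.
    by rewrite nh; apply: le_lt_trans hr; rewrite ler_wpM2l// lerDl.
  rewrite rmorphD /= mulrDl addrA -mulrA (mulrC v) => {}H; apply: le_trans H _.
  rewrite nh mulrAC ler_pdivrMr// -(mulrA e) (ler_wpM2l (ltW e0))//.
  by rewrite ler_wpM2l// lerDl.
split; apply: approx_is_derive => e /H[r r0 {}H]; exists r => // h /H;
  apply: le_trans.
- apply: le_trans (normc_Re _); rewrite !raddfB /=.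
  rewrite le_eqVlt; apply/orP; left; apply/eqP; congr (`| _ |).
  by case: (d * v) => a b /=; ring.
- apply: le_trans (normc_Im _); rewrite !raddfB /=.
  rewrite le_eqVlt; apply/orP; left; apply/eqP; congr (`| _ |).
  by case: (d * v) => a b /=; ring.
Qed.

(** A bound [M] on a slightly larger disc gives the Lipschitz constant [8 M]: the
    derivative is at most [4 M], and the mean value inequality is applied to the real
    and to the imaginary part. *)
Lemma entire_lipschitz f (N M : R) : entire f ->
  (forall z, nrm z <= N + 1 -> nrm (f z) <= M) ->
  forall z w, nrm z <= N -> nrm w <= N -> nrm (f z - f w) <= 8 * M * nrm (z - w).
Proof.
move=> ef fM z w zN wN.
have /boolp.choice[f' df] := fun u => derivable_has_cderiv (ef u).
have f'M u : nrm u <= N -> nrm (f' u) <= 4 * M.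
  move=> uN; rewrite -[4 * M]divr1; apply: cauchy_estimate ef (df u) ltr01 _ => h h1.
  by apply: fM; apply: le_trans (le_normcD _ _) _; apply: lerD.
set v := z - w.
have seg (t : R) : 0 <= t <= 1 -> nrm (w + t%:C * v) <= N.
  move=> /andP[t0 t1].
  have -> : w + t%:C * v = (1 - t)%:C * w + t%:C * z.
    by rewrite /v rmorphB /=; ring.
  apply: le_trans (le_normcD _ _) _; rewrite !normcM !normc_real.
  rewrite !ger0_norm ?subr_ge0//.
  have -> : N = (1 - t) * N + t * N by ring.
  by apply: lerD; rewrite ler_wpM2l// subr_ge0.
have dM (t : R) : 0 <= t <= 1 -> nrm (f' (w + t%:C * v) * v) <= 4 * M * nrm v.
  by move=> t01; rewrite normcM ler_wpM2r ?normc_ge0// f'M// seg.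
have E1 : f z = f (w + (1 : R)%:C * v) by rewrite mul1r /v addrC subrK.
have E0 : f w = f (w + (0 : R)%:C * v) by rewrite mul0r addr0.
have D t := is_derive_segment (df (w + t%:C * v)).
apply: le_trans (normc_le _) _.
have -> : 8 * M * nrm v = 4 * M * nrm v * (1 - 0) + 4 * M * nrm v * (1 - 0) by ring.
rewrite !raddfB /= E1 E0; apply: lerD.
- apply: (mvt_bound (F := fun t => complex.Re (f (w + t%:C * v)))
    (f := fun t => complex.Re (f' (w + t%:C * v) * v)) ler01) => t t01.
    exact: (D t).1.
  exact: le_trans (normc_Re _) (dM t t01).
- apply: (mvt_bound (F := fun t => complex.Im (f (w + t%:C * v)))
    (f := fun t => complex.Im (f' (w + t%:C * v) * v)) ler01) => t t01.
    exact: (D t).2.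
  exact: le_trans (normc_Im _) (dM t t01).
Qed.

(** Tychonoff: a pointwise bounded sequence of functions has a cluster point for the
    topology of pointwise convergence. *)
Lemma pointwise_cluster (f : nat -> R[i] -> R[i]) :
  (forall z, exists B : R, forall n, nrm (f n z) <= B) ->
  exists g, forall (s : seq R[i]) (e : R) (N : nat), 0 < e ->
    exists2 n, (N <= n)%N & forall z, z \in s -> nrm (f n z - g z) <= e.
Proof.
move=> /boolp.choice[B fB].
pose I : choiceType := (R[i] * bool)%type.
pose T (_ : I) : topologicalType := R.
pose c (n : nat) : forall i : I, T i := fun i =>
  if i.2 then complex.Re (f n i.1) else complex.Im (f n i.1).
pose A (i : I) : set (T i) := [set` `[- B i.1, B i.1]].
have cA := @tychonoff I T A (fun i => @segment_compact R (- B i.1) (B i.1)).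
have [|p [_ clp]] := cA (c @ \oo) _.
  exists 0%N => // n _ -[z b] /=; rewrite /A /= in_itv /= -ler_norml /c /=.
  have := fB z n; have := normc_Re (f n z); have := normc_Im (f n z).
  by case: b => h1 h2 h3; [exact: le_trans h2 h3|exact: le_trans h1 h3].
exists (fun z => p (z, true) +i* p (z, false)) => s e N e0.
pose V (i : I) : set (forall i : I, T i) := [set h | `|h i - p i : R| <= e / 2].
have nV i : nbhs p (V i).
  have e2 : 0 < e / 2 by rewrite divr_gt0.
  have nb : nbhs (p i : R) [set y : R | `|y - p i : R| <= e / 2].
    apply/nbhs_ballP; exists (e / 2) => // y /=.
    by move=> /ltW py; rewrite /= distrC.
  exact: (@proj_continuous I T i p _ nb).
have nVs : nbhs p [set h | forall z, z \in s -> V (z, true) h /\ V (z, false) h].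
  elim: s => [|z s IH]; first by apply: filterS (filterT) => h _ z.
  near=> h => w; rewrite in_cons => /predU1P[->|ws].
    by split; near: h; exact: nV.
  by move: w ws; near: h.
have cN : (c @ \oo) [set c n | n in [set n | (N <= n)%N]].
  by exists N => // n Nn; exists n.
have [_ [[n /= Nn <-] Vn]] := clp _ _ cN nVs.
exists n => // z /Vn[h1 h2].
apply: le_trans (normc_le _) _; rewrite (splitr e) !raddfB /=.
exact: lerD h1 h2.
Unshelve. all: by end_near. Qed.

Lemma dense_sequence : exists d : nat -> R[i], forall z (e : R), 0 < e ->
  exists j, nrm (d j - z) <= e.
Proof.
exists (fun j => if @choice.unpickle (rat * rat)%type j is Some q
  then ratr q.1 +i* ratr q.2 else 0) => -[x y] e e0.
have e2 : 0 < e / 2 by rewrite divr_gt0.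
have /rat_in_itvoo[a] : x - e / 2 < x by lra.
rewrite in_itv/= => /andP[a1 a2].
have /rat_in_itvoo[b] : y - e / 2 < y by lra.
rewrite in_itv/= => /andP[b1 b2].
exists (choice.pickle (a, b)); rewrite choice.pickleK.
apply: le_trans (normc_le _) _; rewrite /= (splitr e).
by apply: lerD; rewrite ler_norml; apply/andP; split; lra.
Qed.

(** Montel: the cluster point is approached along a subsequence on more and more
    points of a dense sequence, which is enough by equicontinuity. *)
Lemma montel (f : nat -> R[i] -> R[i]) : (forall n, entire (f n)) ->
  (forall N : R, exists B : R, forall n z, nrm z <= N -> nrm (f n z) <= B) ->
  exists s : nat -> nat, {homo s : m n / (m < n)%N} /\
  exists g, forall z (e : R), 0 < e ->
    exists K : nat, forall k, (K <= k)%N -> nrm (f (s k) z - g z) <= e.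
Proof.
move=> ef fB.
have [g gP] : exists g, forall (s : seq R[i]) (e : R) (N : nat), 0 < e ->
    exists2 n, (N <= n)%N & forall z, z \in s -> nrm (f n z - g z) <= e.
  by apply: pointwise_cluster => z; have [B H] := fB (nrm z); exists B => n; exact: H.
have [d dP] := dense_sequence.
pose l k := [seq d j | j <- iota 0 k.+1].
have /boolp.choice[nx nxP] : forall Nk : nat * nat, exists n, (Nk.1 < n)%N /\
    forall z, z \in l Nk.2 -> nrm (f n z - g z) <= Nk.2.+1%:R^-1.
  move=> [N k]; have [|n nN H] := gP (l k) k.+1%:R^-1 N.+1; first by rewrite invr_gt0.
  by exists n.
pose s k := iteri k (fun k n => nx (n, k)) 0%N.
exists (fun k => s k.+1); split.
  by apply: (homo_ltn ltn_trans) => k; exact: (nxP (s k.+1, k.+1)).1.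
exists g => z e e0.
have [B BP] := fB (nrm z + 2).
have B0 : 0 <= B.
  apply: le_trans (normc_ge0 (f 0%N z)) _; apply: BP; lra.
have lip n w : nrm (w - z) <= 1 -> nrm (f n z - f n w) <= 8 * B * nrm (w - z).
  move=> wz; rewrite (normcB w); apply: (@entire_lipschitz _ (nrm z + 1)) => //.
  - by move=> u uz; apply: BP; lra.
  - by rewrite lerDl.
  - by rewrite -(subrK z w) addrC; apply: le_trans (le_normcD _ _) _; rewrite lerD2l.
have glip w : nrm (w - z) <= 1 -> nrm (g z - g w) <= 8 * B * nrm (w - z).
  move=> wz; apply/ler_addgt0Pr => e' e'0.
  have [|n _ H] := gP [:: z; w] (e' / 2) 0%N; first by rewrite divr_gt0.
  have -> : g z - g w = (f n z - f n w) + ((f n w - g w) - (f n z - g z)) by ring.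
  apply: le_trans (le_normcD _ _) _; apply: lerD; first exact: lip.
  rewrite (splitr e'); apply: le_trans (le_normcD _ _) _; rewrite normcN.
  by apply: lerD; apply: H; rewrite !inE eqxx ?orbT.
pose r := Num.min 1 (e / (3 * (8 * B + 1))).
have B1 : 0 < 8 * B + 1 by lra.
have r0 : 0 < r by rewrite lt_min ltr01 divr_gt0// mulr_gt0.
have [j jz] := dP z r r0.
have jz1 : nrm (d j - z) <= 1 by apply: le_trans jz _; rewrite ge_min lexx.
have jze : 8 * B * nrm (d j - z) <= e / 3.
  have : nrm (d j - z) <= e / (3 * (8 * B + 1)).
    by apply: le_trans jz _; rewrite ge_min lexx orbT.
  rewrite ler_pdivlMr ?mulr_gt0// => H.
  have := normc_ge0 (d j - z); nra.
exists (maxn j (Num.truncn (3 / e)).+1) => k; rewrite geq_max => /andP[jk ke].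
have dl : d j \in l k by apply/mapP; exists j => //; rewrite mem_iota add0n.
have {}H : nrm (f (s k.+1) (d j) - g (d j)) <= k.+1%:R^-1 := (nxP (s k, k)).2 (d j) dl.
have ke3 : k.+1%:R^-1 <= e / 3.
  rewrite -[leRHS]invrK lef_pV2 ?posrE ?invr_gt0 ?divr_gt0// invf_div.
  apply: ltW; apply: lt_le_trans (truncnS_gt _) _.
  by rewrite ler_nat; apply: leq_trans ke _.
have -> : f (s k.+1) z - g z = (f (s k.+1) z - f (s k.+1) (d j))
   + (f (s k.+1) (d j) - g (d j)) - (g z - g (d j)) by ring.
apply: le_trans (le_normcD _ _) _; rewrite normcN.
have -> : e = e / 3 + e / 3 + e / 3 by field.
apply: lerD; last exact: le_trans (glip _ jz1) jze.
apply: le_trans (le_normcD _ _) _; apply: lerD; last exact: le_trans H ke3.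
exact: le_trans (lip (s k.+1) _ jz1) jze.
Qed.

End NormalFamilies.

(** * Partial sums of theta series *)

Section PlaneWaves.
Variable R : realType.
Implicit Types (z w : R[i]).

(** The bound does not depend on [K] nor on [t]. The function [B] of the proof is
    bounded and its increment from [t - 1] to [t] is at least [exp (- |t|)], so that
    the sum telescopes. *)
Lemma sum_expN_dist_le (K : nat) (t : R) : \sum_(i < K) expR (- `|t - i%:R|) <= 4.
Proof.
pose B (t : R) := if t <= 0 then 2 * expR t else 4 - 2 * expR (- t).
have B4 u : 0 <= B u <= 4.
  rewrite /B; case: ifPn => [u0|]; last rewrite -ltNge => u0.
    have := expR_gt0 u; have : expR u <= 1 by rewrite expR_le1.
    lra.
  have := expR_gt0 (- u); have : expR (- u) <= 1 by rewrite expR_le1 oppr_le0 ltW.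
  lra.
have e2 : 2 <= expR 1 :> R by have := expR_ge1Dx (1 : R); lra.
have BS u : expR (- `|u|) + B (u - 1) <= B u.
  rewrite /B.
  have E : expR u * expR (- u) = 1 by rewrite -expRD subrr expR0.
  have Em : expR (u - 1) * expR 1 = expR u by rewrite -expRD subrK.
  have Ep : expR (- (u - 1)) = expR (- u) * expR 1 by rewrite -expRD opprB addrC.
  have [[u0 v0] w0] := (expR_gt0 u, expR_gt0 (- u), expR_gt0 (u - 1)).
  move: E Em Ep u0 v0 w0 e2.
  set a := expR u; set b := expR (- u); set c := expR (u - 1); set e := expR 1.
  move=> E Em Ep u0 v0 w0 e2.
  case: (leP u 0) => u1.
    have -> : u - 1 <= 0 by lra.
    by rewrite ler0_norm// opprK -/a; nra.
  rewrite gtr0_norm// -/b; case: (leP (u - 1) 0) => u2; last by rewrite Ep; nra.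
  have b1 : b <= 1 by rewrite expR_le1 oppr_le0 ltW.
  have be1 : 1 <= b * e by rewrite -expRD -[leLHS]expR0 ler_expR; lra.
  have bce : b * c * e = 1 by rewrite -mulrA Em mulrC.
  have bc : b * c <= 2^-1 by have := mulr_gt0 v0 w0; nra.
  have : 0 <= c * ((1 - b) * (3 * (b * e) - 2)).
    by rewrite mulr_ge0 ?(ltW w0)// mulr_ge0//; lra.
  have -> : c * ((1 - b) * (3 * (b * e) - 2)) =
      3 * (b * c * e) - 2 * c - 3 * b * (b * c * e) + 2 * (b * c) by ring.
  by rewrite bce; lra.
suff H : \sum_(i < K) expR (- `|t - i%:R|) <= B t.
  by apply: le_trans H _; case/andP: (B4 t).
elim: K t => [|K IH] t; first by rewrite big_ord0; case/andP: (B4 t).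
rewrite big_ord_recl subr0; apply: le_trans (BS t); rewrite lerD2l.
apply: le_trans (IH (t - 1)); rewrite le_eqVlt; apply/orP; left; apply/eqP.
by apply: eq_bigr => i _; rewrite /= /bump /= natrD opprD addrA.
Qed.

Variable alpha : R.
Hypothesis alpha_gt0 : 0 < alpha.

(** The functions [exp (alpha / 2 * z ^ 2 + 2 i alpha s z - alpha s ^ 2)]: the
    weighted modulus of such a function is a Gaussian in the imaginary part of [z],
    centred at [- s], and does not depend on the real part. *)
Definition plane_wave (s : R) z : R[i] :=
  cexp ((alpha / 2)%:C * (z * z) + (0 +i* (2 * alpha * s)) * z
        + (- (alpha * s ^+ 2))%:C).

Lemma entire_plane_wave s : entire (plane_wave s).
Proof.
move=> z; apply: (derivable_compC (f := @cexp R) (g := fun z =>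
  (alpha / 2)%:C * (z * z) + (0 +i* (2 * alpha * s)) * z + (- (alpha * s ^+ 2))%:C)).
  exact: derivable_cexp.
have q := derivable_mulC (@derivable_cstC R (alpha / 2)%:C z)
  (derivable_mulC (@derivable_idC R z) (@derivable_idC R z)).
have l := derivable_mulC (@derivable_cstC R (0 +i* (2 * alpha * s)) z) (@derivable_idC R z).
exact: (derivable_addC (derivable_addC q l) (@derivable_cstC R _ z)).
Qed.

Lemma plane_wave_norm s z :
  nrm (plane_wave s z) * expR (- (alpha / 2) * nrm z ^+ 2)
  = expR (- (alpha * (complex.Im z + s) ^+ 2)).
Proof.
rewrite normc_cexp normc_sqr -expRD; congr expR.
by case: z => x y /=; field.
Qed.

(** With this step [d], [alpha d ^ 2 = 16]. *)
Definition wave_step : R := Num.sqrt (16 / alpha).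

(** A partial sum of a theta series: the waves for [s = (i - N + sigma) d], with
    [i] from [0] to [2 N]. The step [d] is large enough for the wave nearest to a
    point to dominate the others, unless the point is about halfway between the
    centres of two of them. *)
Definition theta (sigma : R) (N : nat) z : R[i] :=
  \sum_(i < N.*2.+1) plane_wave ((i%:R - N%:R + sigma) * wave_step) z.

Lemma entire_theta sigma N : entire (theta sigma N).
Proof. by move=> z; apply: derivable_sumC => i; exact: entire_plane_wave. Qed.

(* The imaginary part of [z] in the coordinate where the [i]-th wave of
   [theta sigma N] is centred at [i]. *)
Let tval sigma (N : nat) z := N%:R - sigma - complex.Im z / wave_step.

Lemma theta_term sigma N (i : nat) z :
  nrm (plane_wave ((i%:R - N%:R + sigma) * wave_step) z)
    * expR (- (alpha / 2) * nrm z ^+ 2)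
  = expR (- (16 * (tval sigma N z - i%:R) ^+ 2)).
Proof.
rewrite plane_wave_norm; congr (expR (- _)).
have d0 : 0 < wave_step by rewrite sqrtr_gt0 divr_gt0.
have d2 : wave_step ^+ 2 = 16 / alpha by rewrite sqr_sqrtr// divr_ge0// ltW.
have -> : 16 = alpha * wave_step ^+ 2 by rewrite d2; field; rewrite gt_eqF.
by rewrite /tval; field; rewrite gt_eqF.
Qed.

Lemma theta_le sigma N z :
  nrm (theta sigma N z) * expR (- (alpha / 2) * nrm z ^+ 2) <= 4 * expR 1.
Proof.
apply: (@le_trans _ _ (\sum_(i < N.*2.+1) expR (- (16 * (tval sigma N z - i%:R) ^+ 2)))).
  rewrite -(eq_bigr _ (fun (i : 'I_ _) _ => theta_term sigma N i z)) -mulr_suml.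
  rewrite ler_wpM2r ?expR_ge0//.
  rewrite /theta; elim/big_ind2: _ => [|a b c d ab cd|//]; first by rewrite normc0.
  by apply: le_trans (le_normcD _ _) _; exact: lerD.
rewrite mulrC; apply: le_trans (ler_wpM2l (expR_ge0 _) (sum_expN_dist_le N.*2.+1 (tval sigma N z))).
rewrite mulr_sumr; apply: ler_sum => i _; rewrite -expRD ler_expR.
set x := tval _ _ _ - _; rewrite -(real_normK (num_real x)).
by have := normr_ge0 x; nra.
Qed.

(** Near its centre a wave is at least [exp (- 1)], and the others add up to at most
    [4 exp (- 8)]. *)
Lemma theta_ge sigma N z (k : nat) : (k < N.*2.+1)%N ->
  `|tval sigma N z - k%:R| <= 4^-1 ->
  expR (- 1) / 2 <= nrm (theta sigma N z) * expR (- (alpha / 2) * nrm z ^+ 2).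
Proof.
move=> kN; set t := tval _ _ _ => tk.
pose k' := Ordinal kN.
set W := expR (- (alpha / 2) * nrm z ^+ 2).
rewrite /theta (bigD1 k') //=.
set a := plane_wave _ z; set b := \sum_(i < _ | _) _.
have ha : expR (- 1) <= nrm a * W.
  rewrite theta_term -/t ler_expR; move: tk; rewrite ler_norml => /andP[? ?]; nra.
have e2 : 2 <= expR 1 :> R by have := expR_ge1Dx (1 : R); lra.
have hb : nrm b * W <= expR (- 1) / 2.
  apply: (@le_trans _ _ (\sum_(i < N.*2.+1 | i != k') expR (- (16 * (t - i%:R) ^+ 2)))).
    rewrite -(eq_bigr _ (fun (i : 'I_ _) _ => theta_term sigma N i z)) -mulr_suml.
    rewrite ler_wpM2r ?expR_ge0//.
    rewrite /b; elim/big_ind2: _ => [|u v x y uv xy|//]; first by rewrite normc0.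
    by apply: le_trans (le_normcD _ _) _; exact: lerD.
  apply: (@le_trans _ _ (expR (- 8) * \sum_(i < N.*2.+1) expR (- `|k%:R - i%:R|))).
    rewrite mulr_sumr [leRHS](bigID (fun i => i != k')) /=.
    rewrite -[leLHS]addr0; apply: lerD; last first.
      by apply: sumr_ge0 => i _; rewrite mulr_ge0 ?expR_ge0.
    apply: ler_sum => i ik; rewrite -expRD ler_expR.
    have ik1 : 1 <= `|k%:R - i%:R| :> R.
      have : (i : nat) != k by apply: contra ik => /eqP ik; apply/eqP/val_inj.
      rewrite neq_ltn => /orP[ik'|ik'].
        rewrite ger0_norm ?subr_ge0 ?ler_nat 1?ltnW//.
        by rewrite lerBrDr addrC natr1 ler_nat.
      rewrite distrC ger0_norm ?subr_ge0 ?ler_nat 1?ltnW//.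
      by rewrite lerBrDr addrC natr1 ler_nat.
    have : `|k%:R - i%:R| <= `|t - i%:R| + 4^-1 :> R.
      have -> : k%:R - i%:R = (t - i%:R) - (t - k%:R) by ring.
      by apply: le_trans (ler_normB _ _) _; rewrite lerD2l.
    rewrite -(real_normK (num_real (t - _))); nra.
  apply: le_trans (ler_wpM2l (expR_ge0 _) (sum_expN_dist_le _ _)) _.
  have -> : expR (- 8) = expR (- 1) * expR (- 7) :> R by rewrite -expRD; congr expR; lra.
  have : expR (- 7) <= 8^-1 :> R.
    rewrite expRN lef_pV2 ?posrE ?expR_gt0//.
    by have := expR_ge1Dx (7 : R); lra.
  have := expR_gt0 (- 1 : R); nra.
have : nrm a - nrm b <= nrm (a + b).
  by rewrite lerBlDr -{1}(addrK b a) -(normcN b); apply: le_normcD.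
have := expR_gt0 (- (alpha / 2) * nrm z ^+ 2); rewrite -/W.
move: ha hb; nra.
Qed.

(** At every point of a horizontal strip, one of the sums shifted by [0] and by half
    a step is bounded below. *)
Lemma theta_ge_strip N z : `|complex.Im z| <= (N%:R - 1) * wave_step ->
  exists2 sigma, sigma = 0 \/ sigma = 2^-1 &
  expR (- 1) / 2 <= nrm (theta sigma N z) * expR (- (alpha / 2) * nrm z ^+ 2).
Proof.
move=> zN.
have d0 : 0 < wave_step by rewrite sqrtr_gt0 divr_gt0.
set t := N%:R - complex.Im z / wave_step.
have [t1 tN] : 1 <= t /\ t <= N%:R * 2 - 1.
  move: zN; rewrite -ler_pdivrMr// -[wave_step in X in X -> _]gtr0_norm// -normf_div.
  by rewrite ler_norml => /andP[? ?]; rewrite /t; split; lra.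
have /andP[] : (Num.truncn t)%:R <= t < (Num.truncn t).+1%:R.
  by apply: truncn_itv; lra.
set k := Num.truncn t => kt tk; rewrite -natr1 in tk.
have kN : (k.+1 < N.*2.+1)%N.
  rewrite ltnS -ltnS -(ltr_nat R) -natr1 -natr1 -muln2 natrM; lra.
have [h1|h1] := leP t (k%:R + 4^-1).
  exists 0; first by left.
  apply: (@theta_ge _ _ _ k); first exact: ltnW kN.
  by rewrite /tval subr0 -/t ler_norml; apply/andP; split; lra.
have [h2|h2] := leP t (k%:R + 3 / 4).
  exists 2^-1; first by right.
  apply: (@theta_ge _ _ _ k); first exact: ltnW kN.
  rewrite (_ : tval _ _ _ - _ = t - 2^-1 - k%:R); last by rewrite /tval /t; ring.
  by rewrite ler_norml; apply/andP; split; lra.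
exists 0; first by left.
apply: (@theta_ge _ _ _ k.+1); first exact: kN.
by rewrite /tval subr0 -/t ler_norml -(natr1 k); apply/andP; split; lra.
Qed.

End PlaneWaves.

(** * Nonnegative integrals and Borel measurability in the plane *)

Section MeasureGeneralities.
Context d (T : measurableType d) (R : realType) (m : {measure set T -> \bar R}).
Local Open Scope ereal_scope.

(** No measurability is needed: the integral of a nonnegative function is the
    supremum of the integrals of the simple functions below it. *)
Lemma ge0_le_integral_any (f g : T -> \bar R) :
  (forall x, 0 <= f x) -> (forall x, f x <= g x) ->
  \int[m]_x f x <= \int[m]_x g x.
Proof.
move=> f0 fg; rewrite !ge0_integralTE//; last by move=> x; exact: le_trans (fg x).
by apply: le_ereal_sup => _ [h /= hf <-]; exists h => // x; exact: le_trans (fg x).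
Qed.

(** At most one term of the series is nonzero. *)
Lemma nneseries_disjoint_le (D : nat -> set T) (a : nat -> \bar R) (F : T -> \bar R) x :
  trivIset setT D -> (forall k, 0 <= a k) -> 0 <= F x ->
  (forall k, D k x -> a k <= F x) ->
  \sum_(k <oo) a k * (\1_(D k) x)%:E <= F x.
Proof.
move=> tD a0 F0 aF; apply: lime_le.
  by apply: is_cvg_nneseries => k _ _; rewrite mule_ge0.
near=> n; rewrite big_mkord.
have [[j Dj]|nD] := pselect (exists j : 'I_n, D j x).
  rewrite (bigD1 j) //= big1 ?adde0 => [|k kj].
    by rewrite indicE mem_set// mule1; exact: aF.
  rewrite indicE memNset ?mule0// => Dk.
  move/eqP: kj; apply; apply/val_inj.
  by move/trivIsetP : tD => /(_ k j Logic.I Logic.I) H; apply: contrapT => /eqP /H;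
    apply/eqP/set0P; exists x.
by rewrite big1// => k _; rewrite indicE memNset ?mule0// => Dk; apply: nD; exists k.
Unshelve. all: by end_near. Qed.

(** If [F] is at least [a k] on the [k]-th of disjoint sets of measure at least [q],
    its integral is at least [q] times the sum of the [a k]. *)
Lemma nneseries_le_integral (D : nat -> set T) (a : nat -> \bar R) (q : R)
    (F : T -> \bar R) : trivIset setT D -> (forall k, measurable (D k)) ->
  (0 <= q)%R -> (forall k, q%:E <= m (D k)) -> (forall k, 0 <= a k) ->
  (forall x, 0 <= F x) -> (forall k x, D k x -> a k <= F x) ->
  q%:E * \sum_(k <oo) a k <= \int[m]_x F x.
Proof.
move=> tD mD q0 qD a0 F0 aF.
apply: (@le_trans _ _ (\int[m]_x \sum_(k <oo) a k * (\1_(D k) x)%:E)); last first.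
  apply: ge0_le_integral_any => x.
    by apply: nneseries_ge0 => k _ _; rewrite mule_ge0.
  by apply: nneseries_disjoint_le => // k; exact: aF.
have mf k : measurable_fun setT ((fun x => a k * (\1_(D k) x)%:E) : T -> \bar R).
  apply: measurable_funeM; apply/measurable_EFinP; exact: measurable_indic.
rewrite integral_nneseries//; last by move=> k x _; rewrite mule_ge0.
rewrite -nneseriesZl//; apply: lee_nneseries => k _.
  by move=> _; rewrite mule_ge0.
rewrite ge0_integralZl//; first by rewrite integral_indic// setIT muleC lee_wpmul2l.
by apply/measurable_EFinP; exact: measurable_indic.
Qed.

End MeasureGeneralities.

Section ComplexMeasurability.
Variable R : realType.
Implicit Types (z w : R[i]) (f g : R[i] -> R[i]).

Lemma open_measurableC (U : set R[i]) : open U -> measurable U.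
Proof. by move=> oU; exact: sub_sigma_algebra. Qed.

Lemma measurable_disc z (r : R) : measurable (disc z r).
Proof.
have [r0|r0] := ltP 0 r; first by apply: open_measurableC; apply: ball_open; rewrite ltcR.
rewrite (_ : disc z r = set0)//; rewrite discE; apply/seteqP; split => // w /=.
by move=> /(le_lt_trans (normc_ge0 _)); rewrite ltNge r0.
Qed.

Lemma lipschitz_measurable (h : R[i] -> R) :
  (forall z w, `|h z - h w| <= nrm (z - w)) -> measurable_fun setT h.
Proof.
move=> H mD; apply: (measurability _ (RGenOInfty.measurableE R)) => //.
move=> _ [_ [a ->] <-]; rewrite setTI; apply: open_measurableC.
suff : @open R[i] (h @^-1` `]a, +oo[) by [].
rewrite openE => z /=; rewrite in_itv /= andbT => az.
rewrite /interior -nbhs_ballE; exists (h z - a)%:C; first by rewrite /= ltcR subr_gt0.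
have := discE z (h z - a); rewrite /disc => -> w /= zw.
rewrite in_itv /= andbT; have := le_lt_trans (H z w) zw.
by rewrite ltr_norml => /andP[_]; lra.
Qed.

Lemma measurable_Re : measurable_fun setT (fun z : R[i] => complex.Re z).
Proof.
by apply: lipschitz_measurable => z w; apply: le_trans (normc_Re _); rewrite raddfB.
Qed.

Lemma measurable_Im : measurable_fun setT (fun z : R[i] => complex.Im z).
Proof.
by apply: lipschitz_measurable => z w; apply: le_trans (normc_Im _); rewrite raddfB.
Qed.

Lemma measurable_normc : measurable_fun setT (fun z : R[i] => nrm z).
Proof.
apply: lipschitz_measurable => z w; rewrite ler_norml; apply/andP; split.
  by rewrite lerNl opprB normcB ler_normcB_dist.
exact: ler_normcB_dist.
Qed.

Lemma measurable_complexP d (T : measurableType d) (f : T -> R[i]) :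
  measurable_fun setT (fun x => complex.Re (f x)) ->
  measurable_fun setT (fun x => complex.Im (f x)) -> measurable_fun setT f.
Proof.
move=> mRe mIm.
have -> : f = @complex_of_pair R \o (fun x => (complex.Re (f x), complex.Im (f x))).
  by apply/funext => x; apply: complex_eq.
apply: measurableT_comp; first exact: measurable_complex_of_pair.
exact/measurable_fun_pairP.
Qed.

Lemma entire_measurable f : entire f -> measurable_fun setT f.
Proof.
move=> /entire_continuous cf; apply: (@measurability _ _ _ _ _ _ (@open R[i])) => //.
by move=> _ [U oU <-]; rewrite setTI; apply: open_measurableC; apply: open_comp.
Qed.

End ComplexMeasurability.

(** * Plane Lebesgue measure *)

Section PlaneMeasure.
Variable R : realType.
Implicit Types (z w : R[i]).
Local Notation m := (complex_lebesgue R).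
Local Notation leb := (@lebesgue_measure R).

Lemma complex_lebesgue_square (a b h : R) : 0 <= h ->
  m [set w | a - h < complex.Re w < a + h /\ b - h < complex.Im w < b + h]
  = ((2 * h) ^+ 2)%:E.
Proof.
move=> h0; rewrite /complex_lebesgue /pushforward.
set S := _ @^-1` _.
have -> : S = `]a - h, a + h[%classic `*` `]b - h, b + h[%classic.
  by apply/seteqP; split => -[x y] /=; rewrite !in_itv.
rewrite product_measure1E//= !lebesgue_measure_itv /= !lte_fin.
have [h1|h1] := ltP 0 h; last first.
  have -> : h = 0 by lra.
  by rewrite !subr0 !addr0 !ltxx mul0e mulr0 expr0n.
have -> : a - h < a + h by lra.
have -> : b - h < b + h by lra.
by rewrite -!EFinB -EFinM; congr EFin; ring.
Qed.

Lemma measurable_square (a b h : R) : measurable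
  [set w : R[i] | a - h < complex.Re w < a + h /\ b - h < complex.Im w < b + h].
Proof.
have -> : [set w : R[i] | a - h < complex.Re w < a + h /\ b - h < complex.Im w < b + h]
   = (fun w : R[i] => complex.Re w) @^-1` `]a - h, a + h[
     `&` (fun w : R[i] => complex.Im w) @^-1` `]b - h, b + h[.
  by apply/seteqP; split => -[x y] /=; rewrite !in_itv.
apply: measurableI; rewrite -[X in measurable X]setTI.
  by apply: (@measurable_Re R) => //; exact: measurable_itv.
by apply: (@measurable_Im R) => //; exact: measurable_itv.
Qed.

Lemma complex_lebesgue_disc_ge z (r : R) : 0 < r -> ((r ^+ 2)%:E <= m (disc z r))%E.
Proof.
move=> r0; case: z => a b.
have r2 : 0 <= r / 2 by lra.
have -> : r ^+ 2 = (2 * (r / 2)) ^+ 2 by field.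
rewrite -(complex_lebesgue_square a b r2); apply: le_measure.
- by rewrite inE; exact: measurable_square.
- by rewrite inE; exact: measurable_disc.
- rewrite discE => -[x y] [/= /andP[? ?] /andP[? ?]].
  suff : `|(a - x) +i* (b - y)| < r%:C by rewrite normE ltcR.
  by apply: normC_lt; rewrite ltr_norml; apply/andP; split; lra.
Qed.

Lemma complex_lebesgue_disc_le z (r : R) : 0 <= r ->
  (m (disc z r) <= ((2 * r) ^+ 2)%:E)%E.
Proof.
move=> r0; case: z => a b.
rewrite -(complex_lebesgue_square a b r0); apply: le_measure.
- by rewrite inE; exact: measurable_disc.
- by rewrite inE; exact: measurable_square.
- rewrite discE => -[x y] /= h.
  have := le_lt_trans (normc_Re ((a +i* b) - (x +i* y))) h.
  have := le_lt_trans (normc_Im ((a +i* b) - (x +i* y))) h.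
  by rewrite /= !ltr_norml => /andP[? ?] /andP[? ?]; split; apply/andP; split; lra.
Qed.

Lemma complex_lebesgue_sigma_finite : sigma_finite setT m.
Proof.
exists (fun n => disc 0 n.+1%:R) => [|n]; last first.
  split; first exact: measurable_disc.
  by apply: le_lt_trans (complex_lebesgue_disc_le _ _) (ltry _).
apply/esym/seteqP; split => // z _; exists (Num.truncn (nrm z)) => //.
by rewrite discE /= sub0r normcN truncnS_gt.
Qed.

HB.instance Definition _ :=
  Measure_isSigmaFinite.Build _ _ _ m complex_lebesgue_sigma_finite.

(** The plane Lebesgue measure, in the structure of sigma-finite measures. *)
Definition plane_sigma_finite : {sigma_finite_measure set R[i] -> \bar R} := m.

Section FiniteCopy.
Variables (mu : {measure set R[i] -> \bar R}) (mufin : (mu setT < +oo)%E).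

(** A measure of finite total mass, as an instance of the structure of finite
    measures. *)
Definition finite_copy of (mu setT < +oo)%E : set R[i] -> \bar R := mu.

HB.instance Definition _ := Measure.on (finite_copy mufin).

Lemma finite_copy_fin_num : fin_num_fun (finite_copy mufin).
Proof. exact: lty_fin_num_fun. Qed.

HB.instance Definition _ :=
  @Measure_isFinite.Build _ _ _ (finite_copy mufin) finite_copy_fin_num.

Variables (f : R[i] * R[i] -> \bar R).
Hypotheses (f0 : forall x, (0 <= f x)%E) (mf : measurable_fun setT f).
Let mu' : {finite_measure set R[i] -> \bar R} := finite_copy mufin.

Lemma measurable_integral_finite :
  measurable_fun setT (fun w => \int[mu]_z f (w, z))%E.
Proof. exact: (@measurable_fun_fubini_tonelli_F _ _ _ _ _ mu' f mf f0). Qed.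

Lemma swap_integral_finite :
  (\int[m]_w \int[mu]_z f (w, z) = \int[mu]_z \int[m]_w f (w, z))%E.
Proof. exact: (@fubini_tonelli _ _ _ _ _ plane_sigma_finite mu' f mf f0). Qed.

(** Schur test: a kernel whose integrals in the first variable are bounded by [c]
    has a double integral bounded by [c] times the mass of [mu]. *)
Lemma double_integral_le (c : R) :
  (forall z, \int[m]_w f (w, z) <= c%:E)%E ->
  (\int[m]_w \int[mu]_z f (w, z) <= c%:E * mu setT)%E.
Proof.
move=> fc; rewrite swap_integral_finite -integral_cst//.
by apply: ge0_le_integral_any => // z; apply: integral_ge0.
Qed.

End FiniteCopy.

Lemma measurable_dist : measurable_fun setT (fun x : R[i] * R[i] => nrm (x.1 - x.2)).
Proof.
apply: measurableT_comp; first exact: measurable_normc.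
apply: measurable_complexP.
  under eq_fun do rewrite raddfB /=.
  apply: measurable_funB.
    by apply: (measurableT_comp (@measurable_Re R)); exact: measurable_fst.
  by apply: (measurableT_comp (@measurable_Re R)); exact: measurable_snd.
under eq_fun do rewrite raddfB /=.
apply: measurable_funB.
  by apply: (measurableT_comp (@measurable_Im R)); exact: measurable_fst.
by apply: (measurableT_comp (@measurable_Im R)); exact: measurable_snd.
Qed.

Lemma measure_disc_integral (mu : {measure set R[i] -> \bar R}) (r : R) w :
  mu (disc w r) = (\int[mu]_z (\1_[set x : R[i] * R[i] | nrm (x.1 - x.2) < r] (w, z))%:E)%E.
Proof.
transitivity (\int[mu]_z (\1_(disc w r) z)%:E)%E.
  by rewrite integral_indic ?setIT//; exact: measurable_disc.
by apply: eq_integral => z _; rewrite discE !indicE; congr (_%:R%:E); apply/idP/idP; rewrite !inE.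
Qed.

End PlaneMeasure.

(** * Masses of discs and the Berezin transform *)

Section AveragedMasses.
Variable R : realType.
Implicit Types (z w : R[i]) (mu : {measure set R[i] -> \bar R}).
Local Notation m := (complex_lebesgue R).

Lemma mass_le_covering mu (r : R) (z : nat -> R[i]) : 0 < r -> covering_sequence r z ->
  (mu setT <= l1_norm (fun k => mu (disc (z k) r)))%E.
Proof.
move=> r0 [cov _]; rewrite /l1_norm.
under eq_eseriesr => k _ do rewrite gee0_abs//.
apply: measure_sigma_subadditive => [k||]; [exact: measurable_disc|exact: measurableT|].
rewrite -cov => w [k _ kw]; exists k => //; move: kw; rewrite !discE /= => h.
by apply: lt_le_trans h _; lra.
Qed.

Lemma covering_le_integral (r : R) (z : nat -> R[i]) (a : nat -> \bar R)
    (F : R[i] -> \bar R) : 0 < r -> covering_sequence r z ->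
  (forall k, 0 <= a k)%E -> (forall w, 0 <= F w)%E ->
  (forall k w, nrm (z k - w) < r / 4 -> (a k <= F w)%E) ->
  (((r / 4) ^+ 2)%:E * \sum_(k <oo) a k <= \int[m]_w F w)%E.
Proof.
move=> r0 [_ dis] a0 F0 aF.
apply: (@nneseries_le_integral _ _ _ _ (fun k => disc (z k) (r / 4))) => //.
- by move=> k; exact: measurable_disc.
- exact: sqr_ge0.
- by move=> k; apply: complex_lebesgue_disc_ge; lra.
- by move=> k w; rewrite discE; exact: aF.
Qed.

Lemma disc_subset z w (r s : R) : nrm (z - w) + r <= s -> disc z r `<=` disc w s.
Proof.
move=> h x; rewrite !discE /= => zx; apply: lt_le_trans h.
have -> : w - x = (w - z) + (z - x) by ring.
by apply: le_lt_trans (le_normcD _ _) _; rewrite normcB ltrD2l.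
Qed.

Lemma measure_disc_le mu z w (r s : R) : nrm (z - w) + r <= s ->
  (mu (disc z r) <= mu (disc w s))%E.
Proof.
move=> h; apply: le_measure; rewrite ?inE; [exact: measurable_disc|exact: measurable_disc|].
exact: disc_subset.
Qed.

(** The integral of a function above [c mu (D(., delta))] controls the mass of [mu],
    for any measure [mu]. *)
Lemma mass_le_disc_integral mu (delta c : R) (z : nat -> R[i]) (F : R[i] -> \bar R) :
  0 < delta -> 0 <= c -> covering_sequence (delta / 2) z ->
  (forall w, c%:E * mu (disc w delta) <= F w)%E ->
  (((delta / 8) ^+ 2 * c)%:E * mu setT <= \int[m]_w F w)%E.
Proof.
move=> d0 c0 cov cF; have d2 : 0 < delta / 2 by lra.
apply: (@le_trans _ _ (((delta / 2 / 4) ^+ 2)%:E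
    * \sum_(k <oo) (c%:E * mu (disc (z k) (delta / 2))))%E).
  rewrite nneseriesZl//.
  rewrite muleA -EFinM (_ : delta / 2 / 4 = delta / 8); last by field.
  apply: lee_wpmul2l; first by rewrite lee_fin; exact: mulr_ge0 (sqr_ge0 _) c0.
  apply: le_trans (mass_le_covering mu d2 cov) _; rewrite /l1_norm.
  by under eq_eseriesr => k _ do rewrite gee0_abs//.
apply: (covering_le_integral (a := fun k => (c%:E * mu (disc (z k) (delta / 2)))%E)
    (F := F) d2 cov) => [k|w|k w h].
- by apply: mule_ge0; rewrite ?lee_fin.
- by apply: le_trans (cF w); apply: mule_ge0; rewrite ?lee_fin.
- apply: le_trans (cF w); apply: lee_wpmul2l; first by rewrite lee_fin.
  by apply: measure_disc_le; lra.
Qed.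

Section FiniteMass.
Variables (mu : {measure set R[i] -> \bar R}) (mufin : (mu setT < +oo)%E).

(* The pairs of points at distance less than [delta]. *)
Let near_diag (delta : R) := [set x : R[i] * R[i] | nrm (x.1 - x.2) < delta].

Let measurable_near_diag delta : measurable (near_diag delta).
Proof.
have := @measurable_dist R measurableT _ (measurable_itv `]-oo, delta[).
by rewrite setTI; congr measurable; apply/seteqP; split => x /=; rewrite in_itv.
Qed.

Lemma measurable_disc_mass (delta : R) : measurable_fun setT (fun w => mu (disc w delta)).
Proof.
under eq_fun do rewrite measure_disc_integral.
apply: (measurable_integral_finite mufin
  (f := fun x => (\1_(near_diag delta) x)%:E)) => [x|]; first by rewrite lee_fin.
by apply/measurable_EFinP; exact: measurable_indic.
Qed.

Lemma disc_integral_le_mass (delta : R) : 0 < delta ->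
  (\int[m]_w mu (disc w delta) <= ((2 * delta) ^+ 2)%:E * mu setT)%E.
Proof.
move=> d0; under eq_integral do rewrite measure_disc_integral.
apply: (double_integral_le mufin
  (f := fun x => (\1_(near_diag delta) x)%:E)) => [x||z]; first by rewrite lee_fin.
  by apply/measurable_EFinP; exact: measurable_indic.
apply: le_trans (complex_lebesgue_disc_le z (ltW d0)).
apply: (@le_trans _ _ (\int[m]_w (\1_(disc z delta) w)%:E)%E).
  apply: ge0_le_integral_any => w; first by rewrite lee_fin.
  rewrite lee_fin discE !indicE; case: (boolP (_ \in near_diag _)) => // .
  by rewrite inE /near_diag /= normcB => h; rewrite mem_set.
by rewrite integral_indic ?setIT//; exact: measurable_disc.
Qed.

Lemma covering_le_mass (r : R) (z : nat -> R[i]) : 0 < r -> covering_sequence r z ->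
  (l1_norm (fun k => mu (disc (z k) r)) <= 256%:E * mu setT)%E.
Proof.
move=> r0 cov.
have r4 : 0 < (r / 4) ^+ 2 by rewrite exprn_gt0// divr_gt0.
have H := covering_le_integral (a := fun k => mu (disc (z k) r))
   (F := fun w => mu (disc w (2 * r))) r0 cov (fun k => measure_ge0 _ _)
   (fun k => measure_ge0 _ _).
have {}H := le_trans (H _) (disc_integral_le_mass _).
rewrite /l1_norm; under eq_eseriesr => k _ do rewrite gee0_abs//.
rewrite -(lee_pmul2l _ (_ : 0 < ((r / 4) ^+ 2)%:E)%E) ?lte_fin//.
apply: le_trans (H _ _) _; last first.
- by rewrite muleA -EFinM; apply: lee_wpmul2r => //; rewrite lee_fin; lra.
- by lra.
- by move=> k w h; apply: measure_disc_le; lra.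
Qed.

End FiniteMass.
End AveragedMasses.

Section Gaussian.
Variable R : realType.
Implicit Types (z w : R[i]) (mu : {measure set R[i] -> \bar R}).
Local Notation m := (complex_lebesgue R).

(** Up to its normalisation, the integrand is a normal density. *)
Lemma gaussian_line_integral (a : R) : 0 < a -> exists2 K : R, 0 < K & forall u : R,
  (\int[@lebesgue_measure R]_x (expR (- (a * (x - u) ^+ 2)))%:E = K%:E)%E.
Proof.
move=> a0; pose s := Num.sqrt (2 * a)^-1.
have s0 : s != 0 by rewrite gt_eqF// sqrtr_gt0 invr_gt0 mulr_gt0.
have s2 : s ^+ 2 = (2 * a)^-1 by rewrite sqr_sqrtr// invr_ge0 mulr_ge0// ltW.
have p0 := normal_peak_gt0 s0.
exists (normal_peak s)^-1; first by rewrite invr_gt0.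
move=> u; have E x : expR (- (a * (x - u) ^+ 2)) = (normal_peak s)^-1 * normal_pdf u s x.
  rewrite normal_pdfE// mulrA mulVf ?gt_eqF// mul1r /normal_fun s2; congr expR.
  by rewrite -mulr_natr; field; rewrite gt_eqF.
under eq_integral do rewrite E EFinM.
rewrite ge0_integralZl//.
- by rewrite integral_normal_pdf mule1.
- by apply/measurable_EFinP; exact: measurable_normal_pdf.
- by move=> x _; rewrite lee_fin normal_pdf_ge0.
- by rewrite lee_fin invr_ge0 ltW.
Qed.

Lemma measurable_gaussian_kernel (a : R) :
  measurable_fun setT (fun x : R[i] * R[i] => (expR (- (a * nrm (x.1 - x.2) ^+ 2)))%:E).
Proof.
apply/measurable_EFinP; apply: measurableT_comp => //.
apply: measurableT_comp => //; apply: measurable_funM => //.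
by apply: measurable_funX; exact: measurable_dist.
Qed.

Lemma gaussian_plane_integral (a : R) : 0 < a -> exists2 K : R, 0 < K & forall z : R[i],
  (\int[m]_w (expR (- (a * nrm (w - z) ^+ 2)))%:E = K%:E)%E.
Proof.
move=> /gaussian_line_integral[K K0 HK]; exists (K ^+ 2); first exact: exprn_gt0.
move=> z; pose g (w : R[i]) := (expR (- (a * nrm (w - z) ^+ 2)))%:E.
have mg : measurable_fun setT g.
  apply: (measurableT_comp (measurable_gaussian_kernel a) (g := fun w => (w, z))).
  exact: measurable_pair2.
have g0 : {in setT, forall w, (0 <= g w)%E} by move=> w _; rewrite lee_fin expR_ge0.
pose leb2 : {measure set (measurableTypeR R * measurableTypeR R)%type -> \bar R} :=
  (@lebesgue_measure R \x @lebesgue_measure R)%E.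
have := @ge0_integral_pushforward _ _ (measurableTypeR R * measurableTypeR R)%type
  _ R (@complex_of_pair R) (@measurable_complex_of_pair R) leb2 setT g measurableT mg g0.
rewrite preimage_setT => E; apply: (eq_trans E) => {E}.
pose h (x : R) := expR (- (a * (x - complex.Re z) ^+ 2)).
pose k (x : R) := expR (- (a * (x - complex.Im z) ^+ 2)).
have gE x y : (g \o @complex_of_pair R) (x, y) = (h x * k y)%:E.
  rewrite /g /h /k /complex_of_pair /= -expRD normc_sqr !raddfB /=.
  by congr (expR _)%:E; ring.
rewrite fubini_tonelli1; last 2 first.
- by apply: measurableT_comp => //; exact: measurable_complex_of_pair.
- by move=> x; rewrite lee_fin expR_ge0.
have mk : measurable_fun setT (EFin \o k).
  apply/measurable_EFinP; apply: measurableT_comp => //.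
  apply: measurableT_comp => //; apply: measurable_funM => //.
  by apply: measurable_funX; exact: measurable_funB.
have mh : measurable_fun setT (EFin \o h).
  apply/measurable_EFinP; apply: measurableT_comp => //.
  apply: measurableT_comp => //; apply: measurable_funM => //.
  by apply: measurable_funX; exact: measurable_funB.
transitivity (\int[@lebesgue_measure R]_x ((h x)%:E * K%:E))%E.
  apply: eq_integral => x _; rewrite /fubini_F.
  under eq_integral do rewrite gE EFinM.
  rewrite ge0_integralZl//; first by rewrite HK.
    by move=> y _; rewrite lee_fin expR_ge0.
  by rewrite lee_fin expR_ge0.
rewrite ge0_integralZr//; first by rewrite HK -EFinM expr2.
  by move=> y _; rewrite lee_fin expR_ge0.
by rewrite lee_fin ltW.
Qed.

Variables (alpha t : R) (alpha_gt0 : 0 < alpha) (t_gt0 : 0 < t).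

(** The Berezin transform is the convolution of the measure with a Gaussian. *)
Lemma berezinE mu w : berezin alpha t mu w =
  (\int[mu]_z (expR (- (alpha * t / 2 * nrm (w - z) ^+ 2)))%:E)%E.
Proof.
apply: eq_integral => z _; congr EFin.
rewrite /fock_kernel normc_cexp -expRM -expRD; congr expR.
by rewrite !normc_sqr; case: z => a b; case: w => c d /=; field.
Qed.

Lemma berezin_ge0 mu w : (0 <= berezin alpha t mu w)%E.
Proof. by rewrite berezinE; apply: integral_ge0 => z _; rewrite lee_fin expR_ge0. Qed.

Lemma disc_mass_le_berezin mu w :
  ((expR (- (alpha * t / 2)))%:E * mu (disc w 1) <= berezin alpha t mu w)%E.
Proof.
rewrite berezinE.
have -> : ((expR (- (alpha * t / 2)))%:E * mu (disc w 1) =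
   \int[mu]_z (expR (- (alpha * t / 2)) * \1_(disc w 1) z)%:E)%E.
  under eq_integral do rewrite EFinM.
  rewrite ge0_integralZl ?lee_fin ?expR_ge0//.
    by rewrite integral_indic ?setIT//; exact: measurable_disc.
  by apply/measurable_EFinP; apply: measurable_indic; exact: measurable_disc.
apply: ge0_le_integral_any => z; first by rewrite lee_fin mulr_ge0 ?expR_ge0.
rewrite lee_fin indicE discE; case: (boolP (z \in _)) => [|_].
  rewrite inE /= mulr1 ler_expR lerN2 => h.
  rewrite -[leRHS]mulr1 ler_wpM2l ?divr_ge0 ?mulr_ge0 ?(ltW alpha_gt0) ?(ltW t_gt0)//.
  by rewrite expr_le1 ?normc_ge0// ltW.
by rewrite mulr0 expR_ge0.
Qed.

Lemma mass_le_berezin : (forall r : R, 0 < r -> exists z : nat -> R[i], covering_sequence r z) ->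
  exists2 c : R, 0 < c & forall mu,
    (c%:E * mu setT <= \int[m]_w berezin alpha t mu w)%E.
Proof.
move=> cov; have [|z covz] := cov (1 / 2); first by lra.
exists ((1 / 8) ^+ 2 * expR (- (alpha * t / 2))).
  by rewrite mulr_gt0 ?expR_gt0// exprn_gt0.
move=> mu; apply: mass_le_disc_integral covz _; [by []|exact: expR_ge0|].
exact: disc_mass_le_berezin.
Qed.

Lemma measurable_berezin mu : (mu setT < +oo)%E -> measurable_fun setT (berezin alpha t mu).
Proof.
move=> mufin; rewrite (_ : berezin alpha t mu = fun w => berezin alpha t mu w)//.
under eq_fun do rewrite berezinE.
apply: (measurable_integral_finite mufin
  (f := fun x => (expR (- (alpha * t / 2 * nrm (x.1 - x.2) ^+ 2)))%:E)) => [x|].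
  by rewrite lee_fin expR_ge0.
exact: measurable_gaussian_kernel.
Qed.

Lemma berezin_le_mass : exists2 c : R, 0 < c & forall mu, (mu setT < +oo)%E ->
  (\int[m]_w berezin alpha t mu w <= c%:E * mu setT)%E.
Proof.
have [|K K0 HK] := @gaussian_plane_integral (alpha * t / 2).
  by rewrite divr_gt0// mulr_gt0.
exists K => // mu mufin; under eq_integral do rewrite berezinE.
apply: (double_integral_le mufin
  (f := fun x => (expR (- (alpha * t / 2 * nrm (x.1 - x.2) ^+ 2)))%:E)) => [x||z].
- by rewrite lee_fin expR_ge0.
- exact: measurable_gaussian_kernel.
- by rewrite /= HK.
Qed.

End Gaussian.

(** * Bounds for the embedding *)

Section PowerLemmas.
Variable R : realType.
Local Open Scope ereal_scope.

Lemma le_poweR (x y : \bar R) (r : R) : (0 <= r)%R -> 0 <= x -> x <= y -> x `^ r <= y `^ r.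
Proof.
move=> r0 x0 xy; apply: gt0_ler_poweR => //; rewrite in_itv /= leey andbT//.
exact: le_trans xy.
Qed.

Lemma poweRVK (x : \bar R) (p : R) : (0 < p)%R -> 0 <= x -> (x `^ p^-1) `^ p = x.
Proof. by move=> p0 x0; rewrite -poweRrM mulVf ?gt_eqF// poweRe1. Qed.

Lemma poweRKV (x : \bar R) (p : R) : (0 < p)%R -> 0 <= x -> (x `^ p) `^ p^-1 = x.
Proof. by move=> p0 x0; rewrite -poweRrM mulfV ?gt_eqF// poweRe1. Qed.

Lemma poweRV_le (x y : \bar R) (p : R) : (0 < p)%R -> 0 <= x -> 0 <= y ->
  (x `^ p^-1 <= y) = (x <= y `^ p).
Proof.
move=> p0 x0 y0; apply/idP/idP => h.
  by rewrite -(poweRVK p0 x0); apply: le_poweR h => //; [exact: ltW|exact: poweR_ge0].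
rewrite -[leRHS](poweRKV p0 y0); apply: le_poweR h => //.
by rewrite invr_ge0 ltW.
Qed.

Lemma le_powR (x y r : R) : (0 <= r -> 0 <= x -> x <= y -> x `^ r <= y `^ r)%R.
Proof.
move=> r0 x0 xy; apply: ge0_ler_powR => //; rewrite nnegrE//; exact: le_trans xy.
Qed.

End PowerLemmas.

Section Embedding.
Variables (R : realType) (alpha p : R).
Hypotheses (alpha_gt0 : 0 < alpha) (p_gt0 : 0 < p).
Implicit Types (z w : R[i]) (f g : R[i] -> R[i]) (mu : {measure set R[i] -> \bar R}).

(** The weighted modulus of [f], whose supremum is the norm of [f] in the Fock
    space. *)
Definition wmod f z : R := normc (f z) * expR (- (alpha / 2) * normc z ^+ 2).

(** The [p]-th power of the norm of [f] in the weighted [L^p(mu)]. *)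
Definition wmass mu f : \bar R := (\int[mu]_z (wmod f z `^ p)%:E)%E.

Lemma wmod_ge0 f z : 0 <= wmod f z.
Proof. by rewrite mulr_ge0 ?normc_ge0 ?expR_ge0. Qed.

Lemma wmass_ge0 mu f : (0 <= wmass mu f)%E.
Proof. by apply: integral_ge0 => z _; rewrite lee_fin powR_ge0. Qed.

Lemma weighted_normE mu g : weighted_norm alpha p mu g = (wmass mu g `^ p^-1)%E.
Proof.
rewrite /weighted_norm; congr (_ `^ _)%E; apply: eq_integral => z _.
congr EFin; rewrite /wmod powRM ?normc_ge0 ?expR_ge0// -expRM.
by congr (_ * expR _); ring.
Qed.

Lemma weighted_norm_le mu g (y : \bar R) : (0 <= y)%E ->
  (weighted_norm alpha p mu g <= y)%E = (wmass mu g <= y `^ p)%E.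
Proof. by move=> y0; rewrite weighted_normE poweRV_le// wmass_ge0. Qed.

Lemma weighted_norm_lty mu g :
  (weighted_norm alpha p mu g < +oo)%E = (wmass mu g < +oo)%E.
Proof.
rewrite weighted_normE; apply/idP/idP; last exact: poweR_lty.
by apply: lty_poweRy; rewrite gt_eqF// invr_gt0.
Qed.

Lemma wmod_le_fock_norm f z : ((wmod f z)%:E <= fock_norm alpha f)%E.
Proof. by apply: ereal_sup_ubound; exists z. Qed.

Lemma fock_norm_ge0 f : (0 <= fock_norm alpha f)%E.
Proof. by apply: le_trans (wmod_le_fock_norm f 0); rewrite lee_fin wmod_ge0. Qed.

Lemma fock_norm_le f (M : R) : (forall z, wmod f z <= M) -> (fock_norm alpha f <= M%:E)%E.
Proof. by move=> H; apply: ge_ereal_sup => _ [z _ <-]; rewrite lee_fin; exact: H. Qed.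

Lemma measurable_wmod f : measurable_fun setT f -> measurable_fun setT (wmod f).
Proof.
move=> mf; apply: measurable_funM.
  exact: (measurableT_comp (@measurable_normc R) mf).
apply: measurableT_comp => //; apply: measurable_funM => //.
by apply: measurable_funX; exact: measurable_normc.
Qed.

Lemma measurable_wmod_powR f : measurable_fun setT f ->
  measurable_fun setT (fun z => (wmod f z `^ p)%:E).
Proof.
move=> mf; apply/measurable_EFinP.
exact: (measurableT_comp (measurable_powR p) (measurable_wmod mf)).
Qed.

Lemma wmass_le mu f (M : R) : 0 <= M -> (forall z, wmod f z <= M) ->
  (wmass mu f <= (M `^ p)%:E * mu setT)%E.
Proof.
move=> M0 fM; rewrite -integral_cst//; apply: ge0_le_integral_any => z.
  by rewrite lee_fin powR_ge0.
by rewrite lee_fin; apply: le_powR => //; [exact: ltW|exact: wmod_ge0].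
Qed.

(** A finite measure of mass [v] is Carleson, with constant [v ^ (1 / p)]. *)
Lemma finite_embedding_bound mu (v : R) : mu setT = v%:E ->
  embedding_bound alpha p mu (v `^ p^-1).
Proof.
move=> muv f [ef fn].
have v0 : 0 <= v by rewrite -lee_fin -muv.
have fin : fock_norm alpha f \is a fin_num by rewrite ge0_fin_numE// fock_norm_ge0.
set M := fine (fock_norm alpha f).
have ME : fock_norm alpha f = M%:E by rewrite fineK.
have M0 : 0 <= M by rewrite fine_ge0// fock_norm_ge0.
rewrite ME -EFinM weighted_norm_le ?lee_fin ?mulr_ge0 ?powR_ge0//.
rewrite poweR_EFin powRM ?powR_ge0// -powRrM mulVf ?gt_eqF// powRr1// mulrC.
rewrite EFinM -muv; apply: wmass_le => // z.
by rewrite -lee_fin -ME wmod_le_fock_norm.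
Qed.

Lemma embedding_norm_ge0 mu : (0 <= embedding_norm alpha p mu)%E.
Proof. by apply: le_ereal_inf_tmp => _ [C [C0 _] <-]; rewrite lee_fin. Qed.

Lemma embedding_norm_le_mass mu : (mu setT < +oo)%E ->
  (embedding_norm alpha p mu `^ p <= mu setT)%E.
Proof.
move=> mufin; have fin : mu setT \is a fin_num by rewrite ge0_fin_numE.
have v0 : (0 <= mu setT)%E by [].
rewrite -[leRHS](poweRVK p_gt0 v0).
apply: le_poweR; [exact: ltW|exact: embedding_norm_ge0|].
apply: ereal_inf_lbound; exists (fine (mu setT) `^ p^-1).
  by split; [exact: powR_ge0|apply: finite_embedding_bound; rewrite fineK].
by rewrite -poweR_EFin fineK.
Qed.

Lemma finite_fock_carleson mu : (mu setT < +oo)%E -> fock_carleson alpha p mu.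
Proof.
move=> mufin; exists (fine (mu setT) `^ p^-1); apply: finite_embedding_bound.
by rewrite fineK// ge0_fin_numE.
Qed.

Section Lower.

Local Notation step := (wave_step alpha).

(* The strip on which [theta_ge_strip] applies. *)
Let strip (N : nat) : set R[i] := [set z | `|complex.Im z| <= (N%:R - 1) * step].

Let step_gt0 : 0 < step.
Proof. by rewrite sqrtr_gt0 divr_gt0. Qed.

Let measurable_strip N : measurable (strip N).
Proof.
have := @measurable_Im R measurableT _ (measurable_itv `[- ((N%:R - 1) * step), (N%:R - 1) * step]).
by rewrite setTI; congr measurable; apply/seteqP; split => x; rewrite /strip /= in_itv/= ler_norml.
Qed.

Let strip_homo N N' : (N <= N')%N -> strip N `<=` strip N'.
Proof.
move=> NN z; rewrite /strip /= => /le_trans; apply.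
by rewrite ler_pM2r// lerD2r ler_nat.
Qed.

(** The strips increase to the plane, so that arbitrarily wide ones suffice. *)
Lemma mass_le_of_strips mu (B : \bar R) :
  (forall N, exists2 N', (N <= N')%N & (mu (strip N') <= B)%E) -> (mu setT <= B)%E.
Proof.
move=> H.
have cov : \bigcup_N strip N = setT.
  apply/seteqP; split => // z _; exists (Num.truncn (`|complex.Im z| / step)).+2 => //.
  rewrite /strip /= -ler_pdivrMr// -natr1 addrK ltW//.
  exact: truncnS_gt.
have cvgm := @nondecreasing_cvg_mu _ _ _ mu strip measurable_strip.
rewrite cov in cvgm.
have {}cvgm := cvgm measurableT (fun n m nm => introT (subsetPset _ _) (strip_homo nm)).
rewrite -(cvg_lim _ cvgm)//; apply: lime_le; first by apply/cvg_ex; exists (mu setT).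
near=> n => /=; have [N' nN' N'B] := H n; apply: le_trans N'B.
by apply: le_measure; rewrite ?inE//; exact: strip_homo.
Unshelve. all: by end_near. Qed.

(* The lower bound of [theta_ge] and the upper bound of [theta_le]. *)
Let L : R := expR (- 1) / 2.
Let M : R := 4 * expR 1.

Let L_gt0 : 0 < L. Proof. by rewrite divr_gt0// expR_gt0. Qed.
Let M_gt0 : 0 < M. Proof. by rewrite mulr_gt0// expR_gt0. Qed.

Lemma theta_fock_norm sigma N : (fock_norm alpha (theta alpha sigma N) <= M%:E)%E.
Proof. by apply: fock_norm_le => z; exact: theta_le. Qed.

Lemma theta_fock_space sigma N : fock_space alpha (theta alpha sigma N).
Proof.
split; first exact: entire_theta.
exact: le_lt_trans (theta_fock_norm sigma N) (ltry _).
Qed.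

Lemma strip_le_theta mu N : ((L `^ p)%:E * mu (strip N) <=
  wmass mu (theta alpha 0 N) + wmass mu (theta alpha 2^-1 N))%E.
Proof.
have mth sigma := measurable_wmod_powR (entire_measurable (@entire_theta R alpha sigma N)).
have th0 sigma : forall z, setT z -> (0 <= (wmod (theta alpha sigma N) z `^ p)%:E)%E.
  by move=> z _; rewrite lee_fin powR_ge0.
rewrite /wmass -(ge0_integralD mu measurableT (th0 0) (mth 0) (th0 2^-1) (mth 2^-1)).
have -> : ((L `^ p)%:E * mu (strip N) = \int[mu]_z (L `^ p * \1_(strip N) z)%:E)%E.
  under eq_integral do rewrite EFinM.
  rewrite ge0_integralZl ?lee_fin ?powR_ge0//.
    by rewrite integral_indic ?setIT.
  by apply/measurable_EFinP; exact: measurable_indic.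
apply: ge0_le_integral_any => z; first by rewrite lee_fin mulr_ge0 ?powR_ge0.
rewrite -EFinD lee_fin indicE; case: (boolP (z \in _)); last first.
  by rewrite mulr0 addr_ge0 ?powR_ge0.
rewrite inE mulr1 => /(theta_ge_strip alpha_gt0)[s hs Ls].
have LE : L `^ p <= wmod (theta alpha s N) z `^ p.
  by apply: le_powR => //; [exact: ltW|exact: ltW].
have P0 sigma := powR_ge0 (wmod (theta alpha sigma N) z) p.
by case: hs LE => -> LE; [exact: ler_wpDr (P0 _) LE|exact: ler_wpDl (P0 _) LE].
Qed.

(** A bound on the partial sums of both theta series, along some unbounded sequence
    of indices, bounds the mass of the measure. *)
Lemma mass_le_wmass mu (B : \bar R) (s : nat -> nat) : (forall n, (n <= s n)%N) ->
  (forall n (sigma : R), sigma = 0 \/ sigma = 2^-1 ->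
    (wmass mu (theta alpha sigma (s n)) <= B)%E) ->
  ((L `^ p / 2)%:E * mu setT <= B)%E.
Proof.
move=> sn H.
have Lp : 0 < L `^ p / 2 by rewrite divr_gt0// powR_gt0.
rewrite -lee_pdivlMl//; apply: mass_le_of_strips => N; exists (s N) => //.
rewrite lee_pdivlMl//.
have := strip_le_theta mu (s N) => h.
have {}h := le_trans h (leeD (H N 0 (or_introl erefl)) (H N 2^-1 (or_intror erefl))).
rewrite -(lee_pmul2l (_ : 2%:E \is a fin_num)%E)// muleA -EFinM.
rewrite [(2 * _)%R](_ : _ = L `^ p); last by field.
by apply: le_trans h _; rewrite (_ : 2%:E = 1 + 1)%E// ge0_muleDl ?mul1e.
Qed.

Lemma mass_le_embedding_bound mu (C : R) : 0 <= C -> embedding_bound alpha p mu C ->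
  ((L `^ p / 2)%:E * mu setT <= ((C * M) `^ p)%:E)%E.
Proof.
move=> C0 H; apply: (@mass_le_wmass _ _ id) => // n sigma _.
have := H _ (theta_fock_space sigma n).
move=> /le_trans /(_ (lee_wpmul2l _ (theta_fock_norm sigma n))); rewrite lee_fin => /(_ C0).
by rewrite -EFinM weighted_norm_le ?poweR_EFin// lee_fin mulr_ge0// ltW.
Qed.

(** The constant of the embedding may be taken nonnegative. *)
Lemma fock_carleson_finite mu : fock_carleson alpha p mu -> (mu setT < +oo)%E.
Proof.
move=> [C H].
have HC : embedding_bound alpha p mu (Num.max C 0).
  move=> f ff; apply: le_trans (H f ff) _; apply: lee_wpmul2r; first exact: fock_norm_ge0.
  by rewrite lee_fin le_max lexx.
have C0 : 0 <= Num.max C 0 by rewrite le_max lexx orbT.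
have := mass_le_embedding_bound C0 HC.
rewrite -lee_pdivlMl ?divr_gt0 ?powR_gt0//; move=> /le_lt_trans; apply.
by rewrite -EFinM ltry.
Qed.

Lemma mass_le_embedding_norm : exists2 c : R, 0 < c & forall mu,
  (c%:E * mu setT <= embedding_norm alpha p mu `^ p)%E.
Proof.
have Mp : 0 < M `^ p by rewrite powR_gt0.
exists (L `^ p / 2 / M `^ p); first by rewrite !divr_gt0// powR_gt0.
move=> mu; set c := _ / _.
have cm0 : (0 <= c%:E * mu setT)%E.
  by apply: mule_ge0 => //; rewrite lee_fin !divr_ge0// powR_ge0.
rewrite -(poweRV_le p_gt0 cm0 (embedding_norm_ge0 mu)).
apply: le_ereal_inf_tmp => _ [C [C0 HC] <-].
rewrite poweRV_le ?lee_fin// poweR_EFin /c.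
have := mass_le_embedding_bound C0 HC.
rewrite powRM// ?(ltW M_gt0)// (mulrC (C `^ p)) => h.
rewrite (mulrC (_ / 2)) EFinM -muleA lee_pdivrMl//.
Qed.

End Lower.

End Embedding.

(** * Compactness of the embedding *)

Section Vanishing.
Variables (R : realType) (alpha p : R).
Hypotheses (alpha_gt0 : 0 < alpha) (p_gt0 : 0 < p).
Variable mu : {measure set R[i] -> \bar R}.
Implicit Types (z w : R[i]) (f g : R[i] -> R[i]).
Local Notation wmod := (wmod alpha).
Local Notation wmass := (wmass alpha p mu).

Lemma wmodD_le f g z : wmod f z <= wmod (fun w => f w - g w) z + wmod g z.
Proof.
rewrite -mulrDl ler_wpM2r ?expR_ge0//.
by rewrite -{1}(subrK (g z) (f z)); exact: le_normcD.
Qed.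

Lemma wmodB_le f g z : wmod (fun w => f w - g w) z <= wmod f z + wmod g z.
Proof.
rewrite -mulrDl ler_wpM2r ?expR_ge0//.
by rewrite -(normcN (g z)); exact: le_normcD.
Qed.

Lemma cvge_near_lt (u : nat -> \bar R) (a b : \bar R) :
  u n @[n --> \oo] --> a -> (a < b)%E -> \forall n \near \oo, (u n < b)%E.
Proof. by move=> cu ab; exact: cu _ (open_ereal_lt' ab). Qed.

Lemma powRD_le (x y : R) : 0 <= x -> 0 <= y ->
  (x + y) `^ p <= 2 `^ p * x `^ p + 2 `^ p * y `^ p.
Proof.
move=> x0 y0; have p0 := ltW p_gt0.
wlog xy : x y x0 y0 / x <= y.
  move=> H; have [|/ltW yx] := leP x y; first exact: H.
  by rewrite addrC [leRHS]addrC; exact: H.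
rewrite -!powRM//; apply: ler_wpDl; first exact: powR_ge0.
by apply: le_powR => //; [exact: addr_ge0|lra].
Qed.

Lemma measurableB f g : measurable_fun setT f -> measurable_fun setT g ->
  measurable_fun setT (fun z => (f z - g z)%R).
Proof.
move=> mf mg; apply: measurable_complexP.
  under eq_fun do rewrite raddfB /=.
  by apply: measurable_funB; apply: (measurableT_comp (@measurable_Re R)).
under eq_fun do rewrite raddfB /=.
by apply: measurable_funB; apply: (measurableT_comp (@measurable_Im R)).
Qed.

Lemma wmass_triangle f g : measurable_fun setT f -> measurable_fun setT g ->
  (wmass f <= (2 `^ p)%:E * (wmass (fun z => (f z - g z)%R)) + (2 `^ p)%:E * (wmass g))%E.
Proof.
move=> mf mg.
have m1 := measurable_wmod_powR alpha p (measurableB mf mg).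
have m2 := measurable_wmod_powR alpha p mg.
have c0 : 0 <= 2 `^ p :> R by exact: powR_ge0.
have P0 h : forall z, setT z -> (0 <= (wmod h z `^ p)%:E)%E.
  by move=> z _; rewrite lee_fin powR_ge0.
rewrite /wmass -(ge0_integralZl _ measurableT m1 (P0 _))// -(ge0_integralZl _ measurableT m2 (P0 _))//.
rewrite -ge0_integralD//=; first last.
- exact: measurable_funeM.
- by move=> z _; apply: mule_ge0; rewrite lee_fin// powR_ge0.
- exact: measurable_funeM.
- by move=> z _; apply: mule_ge0; rewrite lee_fin// powR_ge0.
apply: ge0_le_integral_any => z; first by rewrite lee_fin powR_ge0.
rewrite -!EFinM -EFinD lee_fin.
apply: le_trans (powRD_le (wmod_ge0 _ _ _) (wmod_ge0 _ _ _)).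
by apply: le_powR; [exact: ltW|exact: wmod_ge0|exact: wmodD_le].
Qed.

(** A bounded sequence of the Fock space has a subsequence that is bounded in
    [L^p(mu)]: a tail of a convergent one. *)
Lemma vanishing_bounded_subsequence (f : nat -> R[i] -> R[i]) (M : R) :
  vanishing_fock_carleson alpha p mu ->
  (forall n, fock_space alpha (f n)) -> (forall n, fock_norm alpha (f n) <= M%:E)%E ->
  exists2 s : nat -> nat, (forall n, (n <= s n)%N) &
  exists2 B : R, 0 <= B & forall n, (wmass (f (s n)) <= B%:E)%E.
Proof.
move=> [emb cpt] ff fM.
have [s [smono [g [[mg gfin] sg]]]] := cpt f ff (ex_intro _ M fM).
have sle n : (n <= s n)%N.
  by elim: n => // n IH; exact: leq_ltn_trans IH (smono _ _ (ltnSn n)).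
have Gfin : (wmass g < +oo)%E by rewrite -weighted_norm_lty.
have Gfn : wmass g \is a fin_num by rewrite ge0_fin_numE// wmass_ge0.
have [K KP] : exists K : nat, forall k, (K <= k)%N ->
    (weighted_norm alpha p mu (fun z => (f (s k) z - g z)%R) <= 1%:E)%E.
  have : \forall k \near \oo, (weighted_norm alpha p mu (fun z => (f (s k) z - g z)%R) <= 1%:E)%E.
    have := cvge_near_lt sg (@lte01 R).
    by apply: filterS => k /ltW.
  by move=> [K _ KP]; exists K => k Kk; exact: KP.
exists (fun n => s (n + K)%N) => [n|].
  by apply: leq_trans (sle _); exact: leq_addr.
exists (2 `^ p + 2 `^ p * fine (wmass g)).
  by rewrite addr_ge0// ?mulr_ge0 ?powR_ge0// fine_ge0// wmass_ge0.
move=> n; have [mf _] := emb _ (ff (s (n + K)%N)).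
apply: le_trans (wmass_triangle mf mg) _.
rewrite EFinD EFinM fineK//; apply: leeD => //.
have := KP (n + K)%N (leq_addl _ _).
rewrite weighted_norm_le ?lee_fin// poweR_EFin powR1 => h.
by rewrite -[leRHS]mule1; apply: lee_wpmul2l => //; rewrite lee_fin powR_ge0.
Qed.

(** The partial sums of both theta series are bounded in [L^p(mu)] along a common
    subsequence, extracted in two stages. *)
Lemma vanishing_finite : vanishing_fock_carleson alpha p mu -> (mu setT < +oo)%E.
Proof.
move=> van.
have [s0 s0n [B0 B00 HB0]] := vanishing_bounded_subsequence van
  (fun n => theta_fock_space alpha_gt0 0 n) (fun n => theta_fock_norm alpha_gt0 0 n).
have [s1 s1n [B1 B10 HB1]] := vanishing_bounded_subsequence van
  (fun n => theta_fock_space alpha_gt0 2^-1 (s0 n))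
  (fun n => theta_fock_norm alpha_gt0 2^-1 (s0 n)).
have := @mass_le_wmass R alpha p alpha_gt0 p_gt0 mu (B0 + B1)%:E (fun n => s0 (s1 n)).
move=> /(_ (fun n => leq_trans (s1n n) (s0n _))) H.
have Hb n (sigma : R) : sigma = 0 \/ sigma = 2^-1 ->
    (wmass (theta alpha sigma (s0 (s1 n))) <= (B0 + B1)%:E)%E.
  case=> ->; [apply: le_trans (HB0 _) _|apply: le_trans (HB1 _) _].
    by rewrite lee_fin lerDl.
  by rewrite lee_fin lerDr.
have {}H := H Hb.
have L0 : 0 < (expR (- 1) / 2) `^ p / 2 :> R.
  by rewrite divr_gt0// powR_gt0// divr_gt0// expR_gt0.
move: H; rewrite -lee_pdivlMl// => /le_lt_trans; apply.
by rewrite -EFinM ltry.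
Qed.

Hypothesis mufin : (mu setT < +oo)%E.

Lemma finite_weighted_Lp f : fock_space alpha f -> weighted_Lp alpha p mu f.
Proof.
move=> [ef fn]; split; first exact: entire_measurable.
have fin : fock_norm alpha f \is a fin_num by rewrite ge0_fin_numE// fock_norm_ge0.
have muE : mu setT = (fine (mu setT))%:E by rewrite fineK// ge0_fin_numE.
apply: le_lt_trans (finite_embedding_bound p_gt0 muE (conj ef fn)) _.
by rewrite -(fineK fin) -EFinM ltry.
Qed.

(** Dominated convergence: the measure is finite and the weighted moduli are bounded. *)
Lemma wmass_cvg0 (h : nat -> R[i] -> R[i]) (M : R) :
  (forall n, measurable_fun setT (h n)) ->
  (forall n z, wmod (h n) z <= M) ->
  (forall z (e : R), 0 < e -> exists K : nat, forall n, (K <= n)%N -> nrm (h n z) <= e) ->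
  (wmass (h n) @[n --> \oo] --> 0)%E.
Proof.
move=> mh hM h0.
have p0 := ltW p_gt0.
have [] := @dominated_convergence _ _ R mu setT measurableT
  (fun n z => (wmod (h n) z `^ p)%:E) (fun _ => 0%E) (fun _ => (M `^ p)%:E).
- by move=> n; exact: measurable_wmod_powR.
- exact: measurable_cst.
- apply: aeW => z _; apply: cvg_EFin; first by near=> n.
  apply/cvgrPdist_le => /= e e0.
  pose e' := e `^ p^-1.
  have e'0 : 0 < e' by exact: powR_gt0.
  have [K KP] := h0 z e' e'0.
  exists K => // n /= Kn; rewrite sub0r normrN ger0_norm ?powR_ge0//.
  have -> : e = e' `^ p by rewrite -powRrM mulVf ?gt_eqF// powRr1// ltW.
  apply: le_powR => //; first exact: wmod_ge0.
  apply: le_trans (KP n Kn); rewrite -[leRHS]mulr1 /wmod.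
  apply: ler_wpM2l; first exact: normc_ge0.
  rewrite expR_le1 mulNr oppr_le0 mulr_ge0 ?sqr_ge0//.
  by rewrite divr_ge0// ltW.
- apply/integrableP; split; first exact: measurable_cst.
  rewrite integral_cst//= ger0_norm ?powR_ge0//.
  have -> : mu setT = (fine (mu setT))%:E by rewrite fineK// ge0_fin_numE.
  by rewrite -EFinM ltry.
- apply: aeW => z n _; rewrite /= ger0_norm ?powR_ge0// lee_fin.
  by apply: le_powR => //; exact: wmod_ge0.
- move=> _ _; rewrite integral0; exact.
Unshelve. all: by end_near. Qed.

Lemma finite_vanishing : vanishing_fock_carleson alpha p mu.
Proof.
split; first exact: finite_weighted_Lp.
move=> f ff [M fM].
have wM n z : wmod (f n) z <= M.
  by rewrite -lee_fin; apply: le_trans (wmod_le_fock_norm _ _ _) (fM n).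
have M0 : 0 <= M by apply: le_trans (wM 0%N 0); exact: wmod_ge0.
have ef n : entire (f n) by have [] := ff n.
have [N|s [smono [g sg]]] := montel ef.
  exists (M * expR (alpha / 2 * N ^+ 2)) => n z zN.
  have -> : nrm (f n z) = wmod (f n) z * expR (alpha / 2 * nrm z ^+ 2).
    by rewrite -[RHS]mulrA -expRD mulNr addNr expR0 mulr1.
  apply: ler_pM; [exact: wmod_ge0|exact: expR_ge0|exact: wM|].
  rewrite ler_expR ler_wpM2l ?divr_ge0 ?(ltW alpha_gt0)//.
  rewrite ler_sqr ?nnegrE ?normc_ge0//; exact: le_trans (normc_ge0 z) zN.
have mf n : measurable_fun setT (f n) by exact: entire_measurable.
have gcvg (q : R[i] -> R) z : (forall a b, q (a - b) = q a - q b) ->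
    (forall a, `|q a| <= nrm a) -> q (f (s k) z) @[k --> \oo] --> q (g z).
  move=> qB qn; apply/cvgrPdist_le => /= e e0; have [K KP] := sg z e e0.
  exists K => // k /= Kk; rewrite distrC -qB.
  exact: le_trans (qn _) (KP k Kk).
have mg : measurable_fun setT g.
  apply: measurable_complexP.
    apply: (measurable_fun_cvg (h := fun k z => complex.Re (f (s k) z))).
      by move=> k; exact: (measurableT_comp (@measurable_Re R)).
    move=> z _; apply: (gcvg (fun z => complex.Re z)) => [a b|a]; last exact: normc_Re.
    by rewrite raddfB.
  apply: (measurable_fun_cvg (h := fun k z => complex.Im (f (s k) z))).
    by move=> k; exact: (measurableT_comp (@measurable_Im R)).
  move=> z _; apply: (gcvg (fun z => complex.Im z)) => [a b|a]; last exact: normc_Im.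
  by rewrite raddfB.
have gM z : wmod g z <= M.
  apply/ler_addgt0Pr => e e0; have [K KP] := sg z e e0.
  apply: le_trans (wmodD_le g (f (s K)) z) _; rewrite addrC; apply: lerD => //.
  apply: le_trans (KP K (leqnn K)); rewrite normcB /wmod -[leRHS]mulr1.
  apply: ler_wpM2l; first exact: normc_ge0.
  rewrite expR_le1 mulNr oppr_le0 mulr_ge0 ?sqr_ge0//.
  by rewrite divr_ge0// ltW.
exists s; split => //; exists g; split.
  split => //; rewrite weighted_norm_lty//.
  apply: le_lt_trans (wmass_le p_gt0 mu M0 gM) _.
  have -> : mu setT = (fine (mu setT))%:E by rewrite fineK// ge0_fin_numE.
  by rewrite -EFinM ltry.
have cv : (wmass (fun z => (f (s n) z - g z)%R) @[n --> \oo] --> 0)%E.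
  apply: (@wmass_cvg0 (fun n z => f (s n) z - g z) (M + M)) => [n|n z|//].
    exact: measurableB.
  by apply: le_trans (wmodB_le _ _ _) _; exact: lerD.
apply/fine_cvgP; split.
  have : \forall n \near \oo, (wmass (fun z => (f (s n) z - g z)%R) < 1%:E)%E.
    by apply: (cvge_near_lt cv); rewrite lte_fin.
  apply: filterS => n n1; rewrite weighted_normE fin_num_poweR//.
  by rewrite ge0_fin_numE ?wmass_ge0//; apply: lt_trans n1 (ltry _).
apply/cvgrPdist_le => /= e e0.
have : \forall n \near \oo, (wmass (fun z => (f (s n) z - g z)%R) < (e `^ p)%:E)%E.
  by apply: (cvge_near_lt cv); rewrite lte_fin powR_gt0.
apply: filterS => n /ltW n1; rewrite sub0r normrN.
have : (weighted_norm alpha p mu (fun z => (f (s n) z - g z)%R) <= e%:E)%E.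
  have e0' : (0 <= e%:E)%E by rewrite lee_fin ltW.
  by rewrite (weighted_norm_le alpha p_gt0 mu _ e0') poweR_EFin.
have : (0 <= weighted_norm alpha p mu (fun z => (f (s n) z - g z)%R))%E.
  by rewrite weighted_normE poweR_ge0.
case: (weighted_norm _ _ _ _) => //= r r0 re.
by rewrite ger0_norm.
Qed.

End Vanishing.

(** * Comparison with the total mass *)

Section Comparison.
Variable R : realType.
Local Notation m := (complex_lebesgue R).
Local Notation meas := {measure set R[i] -> \bar R}.
Local Open Scope ereal_scope.

(** [U mu] is comparable with the mass of [mu], with constant [K]. *)
Definition mass_comparable (K : R) (U : meas -> \bar R) :=
  forall mu, U mu <= K%:E * mu setT /\ mu setT <= K%:E * U mu.

(** The bound from above is only required for finite measures, since it is trivial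
    when the mass is infinite. *)
Lemma mass_comparable_of_bounds (U : meas -> \bar R) (c C : R) : (0 < c)%R ->
  (forall mu, 0 <= U mu) -> (forall mu : meas, c%:E * mu setT <= U mu) ->
  (forall mu : meas, mu setT < +oo -> U mu <= C%:E * mu setT) ->
  exists2 K : R, (0 < K)%R & mass_comparable K U.
Proof.
move=> c0 U0 cU UC; exists (Num.max C c^-1)%R.
  by rewrite lt_max invr_gt0 c0 orbT.
move=> mu; split.
  have [mufin|] := ltP (mu setT) +oo.
    by apply: le_trans (UC _ mufin) _; apply: lee_wpmul2r; rewrite // lee_fin le_max lexx.
  rewrite leye_eq => /eqP ->; rewrite gt0_muley ?leey// lte_fin.
  by rewrite lt_max invr_gt0 c0 orbT.
apply: (@le_trans _ _ (c^-1%:E * U mu)); first by rewrite lee_pdivlMl.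
by apply: lee_wpmul2r => //; rewrite lee_fin le_max lexx orbT.
Qed.

Lemma mass_comparable_le (K K' : R) (U : meas -> \bar R) : (K <= K')%R ->
  (forall mu, 0 <= U mu) -> mass_comparable K U -> mass_comparable K' U.
Proof.
move=> KK U0 H mu; have [h1 h2] := H mu; split.
  by apply: le_trans h1 _; apply: lee_wpmul2r; rewrite ?lee_fin.
by apply: le_trans h2 _; apply: lee_wpmul2r; rewrite ?lee_fin.
Qed.

Lemma mass_comparable_bounded_ratio (K : R) (U V : meas -> \bar R) (mu : meas) :
  (0 < K)%R -> mass_comparable K U -> mass_comparable K V ->
  bounded_ratio (K * K)%R (U mu) (V mu).
Proof.
move=> K0 /(_ mu)[h1 h2] /(_ mu)[h3 h4].
have KK : (0 < K * K)%R by rewrite mulr_gt0.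
have KE : 0 <= K%:E by rewrite lee_fin ltW.
split; last by rewrite EFinM -muleA; apply: le_trans h1 _; exact: lee_wpmul2l.
by rewrite lee_pdivrMl// EFinM -muleA; apply: le_trans h3 _; exact: lee_wpmul2l.
Qed.

Variables (alpha p : R) (zs : R -> nat -> R[i]).
Hypotheses (alpha_gt0 : (0 < alpha)%R) (p_gt0 : (0 < p)%R).
Hypothesis zsP : forall r : R, (0 < r)%R -> covering_sequence r (zs r).

Lemma Lnorm1_ge0 (F : R[i] -> \bar R) : (forall w, 0 <= F w) ->
  'N[m]_1[F] = \int[m]_w F w.
Proof. by move=> F0; rewrite Lnorm1; apply: eq_integral => w _; rewrite gee0_abs. Qed.

Lemma embedding_norm_comparable : exists2 K : R, (0 < K)%R &
  mass_comparable K (fun mu => embedding_norm alpha p mu `^ p).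
Proof.
have [c c0 H] := mass_le_embedding_norm alpha_gt0 p_gt0.
apply: (mass_comparable_of_bounds (C := 1%R) c0) => // mu.
  exact: poweR_ge0.
by rewrite mul1e; exact: embedding_norm_le_mass.
Qed.

Lemma berezin_comparable (t : R) : (0 < t)%R -> exists2 K : R, (0 < K)%R &
  mass_comparable K (fun mu => 'N[m]_1[berezin alpha t mu]).
Proof.
move=> t0.
have [c c0 H] := mass_le_berezin alpha_gt0 t0 (fun r r0 => ex_intro _ _ (zsP r0)).
have [C _ H'] := berezin_le_mass alpha_gt0 t0.
have E mu := Lnorm1_ge0 (berezin_ge0 alpha t mu).
apply: (mass_comparable_of_bounds (C := C) c0) => mu; rewrite E.
- by apply: integral_ge0 => w _; exact: berezin_ge0.
- exact: H.
- exact: H'.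
Qed.

Lemma disc_mass_comparable (r : R) : (0 < r)%R -> exists2 K : R, (0 < K)%R &
  mass_comparable K (fun mu => 'N[m]_1[(fun z => mu (disc z r))]).
Proof.
move=> r0.
have E (mu : meas) := @Lnorm1_ge0 (fun z => mu (disc z r)) (fun z => measure_ge0 _ _).
have c0 : (0 < (r / 8) ^+ 2 * 1)%R by rewrite mulr1 exprn_gt0// divr_gt0.
apply: (mass_comparable_of_bounds (C := ((2 * r) ^+ 2)%R) c0) => mu; rewrite E.
- by apply: integral_ge0 => w _.
- apply: (mass_le_disc_integral r0 ler01 (zsP (_ : 0 < r / 2)%R)); first by rewrite divr_gt0.
  by move=> w; rewrite mul1e.
- by move=> mufin; exact: disc_integral_le_mass.
Qed.

Lemma covering_comparable (r : R) : (0 < r)%R -> exists2 K : R, (0 < K)%R &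
  mass_comparable K (fun mu => l1_norm (fun k => mu (disc (zs r k) r))).
Proof.
move=> r0; apply: (mass_comparable_of_bounds (C := 256%R) ltr01) => mu.
- by apply: nneseries_ge0.
- by rewrite mul1e; exact: mass_le_covering (zsP r0).
- by move=> mufin; exact: covering_le_mass (zsP r0).
Qed.

Lemma mass_comparable_lty (K : R) (U : meas -> \bar R) (mu : meas) :
  (0 < K)%R -> (forall mu, 0 <= U mu) -> mass_comparable K U ->
  (U mu < +oo) = (mu setT < +oo).
Proof.
move=> K0 U0 /(_ mu)[h1 h2].
have lty x : 0 <= x -> x < +oo -> K%:E * x < +oo.
  by move=> x0 xoo; rewrite -(@fineK _ x) ?ge0_fin_numE// -EFinM ltry.
apply/idP/idP => h; first exact: le_lt_trans h2 (lty _ (U0 _) h).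
exact: le_lt_trans h1 (lty _ (measure_ge0 _ _) h).
Qed.

Lemma integrable_Lnorm1 (F : R[i] -> \bar R) : measurable_fun setT F ->
  m.-integrable setT F <-> 'N[m]_1[F] < +oo.
Proof.
move=> mF; rewrite Lnorm1; split; first by move=> /integrableP[].
by move=> H; apply/integrableP.
Qed.

Lemma integrable_berezinP (t : R) (mu : meas) : (0 < t)%R ->
  m.-integrable setT (berezin alpha t mu) <-> mu setT < +oo.
Proof.
move=> t0; have [K K0 HK] := berezin_comparable t0.
have E := mass_comparable_lty mu K0 (fun mu => Lnorm_ge0 _ _ _) HK.
split=> [/integrableP[_]|mufin]; first by rewrite -Lnorm1 E.
by apply/integrable_Lnorm1; [exact: measurable_berezin|rewrite E].
Qed.

Lemma integrable_disc_massP (r : R) (mu : meas) : (0 < r)%R ->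
  m.-integrable setT (fun z => mu (disc z r)) <-> mu setT < +oo.
Proof.
move=> r0; have [K K0 HK] := disc_mass_comparable r0.
have E := mass_comparable_lty mu K0 (fun mu => Lnorm_ge0 _ _ _) HK.
split=> [/integrableP[_]|mufin]; first by rewrite -Lnorm1 E.
by apply/integrable_Lnorm1; [exact: measurable_disc_mass|rewrite E].
Qed.

Lemma covering_ltyP (r : R) (mu : meas) : (0 < r)%R ->
  l1_norm (fun k => mu (disc (zs r k) r)) < +oo <-> mu setT < +oo.
Proof.
move=> r0; have [K K0 HK] := covering_comparable r0.
have U0 (nu : meas) : 0 <= l1_norm (fun k => nu (disc (zs r k) r)).
  by apply: nneseries_ge0.
by rewrite (mass_comparable_lty mu K0 U0 HK).
Qed.

End Comparison.
Theorem proposition2p6 (R : realType) (alpha p : R) (zs : R -> nat -> R[i])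
    (alpha_gt0 : 0 < alpha) (p_gt0 : 0 < p)
    (zsP : forall r : R, 0 < r -> covering_sequence r (zs r)) :
  (forall mu : {measure set R[i] -> \bar R},
    [<-> fock_carleson alpha p mu;
         vanishing_fock_carleson alpha p mu;
         (exists2 t : R, 0 < t & (complex_lebesgue R).-integrable setT (berezin alpha t mu));
         (forall t : R, 0 < t -> (complex_lebesgue R).-integrable setT (berezin alpha t mu));
         (mu setT < +oo)%E;
         (exists2 r : R, 0 < r &
            (complex_lebesgue R).-integrable setT (fun z => mu (disc z r)));
         (forall r : R, 0 < r ->
            (complex_lebesgue R).-integrable setT (fun z => mu (disc z r)));
         (exists2 r : R, 0 < r &
            (l1_norm (fun k => mu (disc (zs r k) r)) < +oo)%E);
         (forall r : R, 0 < r ->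
            (l1_norm (fun k => mu (disc (zs r k) r)) < +oo)%E)]) /\
  (forall t delta r : R, 0 < t -> 0 < delta -> 0 < r ->
    exists2 C : R, 0 < C & forall mu : {measure set R[i] -> \bar R},
      [/\ bounded_ratio C (embedding_norm alpha p mu `^ p)%E
            ('N[complex_lebesgue R]_1[berezin alpha t mu])%E,
          bounded_ratio C ('N[complex_lebesgue R]_1[berezin alpha t mu])%E
            ('N[complex_lebesgue R]_1[(fun z => mu (disc z delta))])%E
        & bounded_ratio C ('N[complex_lebesgue R]_1[(fun z => mu (disc z delta))])%E
            (l1_norm (fun k => mu (disc (zs r k) r)))]).
Proof.
split=> [mu|t delta r t0 d0 r0].
  have B t (t0 : 0 < t) := integrable_berezinP alpha_gt0 zsP mu t0.
  have D r (r0 : 0 < r) := integrable_disc_massP zsP mu r0.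
  have S r (r0 : 0 < r) := covering_ltyP zsP mu r0.
  tfae.
  - by move=> /(fock_carleson_finite alpha_gt0 p_gt0); exact: finite_vanishing.
  - by move=> /(vanishing_finite alpha_gt0 p_gt0) h; exists 1 => //; exact/B.
  - by move=> [t t0 /(B t t0)] h s s0; exact/B.
  - by move=> /(_ 1 ltr01) /(B 1 ltr01).
  - by move=> h; exists 1 => //; exact/D.
  - by move=> [r r0 /(D r r0)] h s s0; exact/D.
  - by move=> /(_ 1 ltr01) /(D 1 ltr01) h; exists 1; [exact: ltr01|exact/(S 1 ltr01)].
  - by move=> [r r0 /(S r r0) h] s s0; exact/(S s s0).
  - by move=> /(_ 1 ltr01) /(S 1 ltr01); exact: finite_fock_carleson.
have [K1 K10 H1] := embedding_norm_comparable alpha_gt0 p_gt0.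
have [K2 K20 H2] := berezin_comparable alpha_gt0 zsP t0.
have [K3 K30 H3] := disc_mass_comparable zsP d0.
have [K4 K40 H4] := covering_comparable zsP r0.
(* A common constant for the four comparisons with the mass. *)
pose K := K1 + K2 + K3 + K4.
have K0 : 0 < K by rewrite /K; lra.
have {}H1 : mass_comparable K (fun mu => embedding_norm alpha p mu `^ p)%E.
  by apply: mass_comparable_le H1; [rewrite /K; lra|move=> ?; exact: poweR_ge0].
have {}H2 := mass_comparable_le (_ : K2 <= K) (fun mu => Lnorm_ge0 _ _ _) H2.
have {}H3 := mass_comparable_le (_ : K3 <= K) (fun mu => Lnorm_ge0 _ _ _) H3.
have {}H4 : mass_comparable K (fun mu => l1_norm (fun k => mu (disc (zs r k) r))).
  apply: mass_comparable_le H4; first by rewrite /K; lra.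
  by move=> ?; apply: nneseries_ge0.
have {}H2 := H2 ltac:(by rewrite /K; lra).
have {}H3 := H3 ltac:(by rewrite /K; lra).
exists (K * K) => [|mu]; first exact: mulr_gt0.
split.
- exact: (mass_comparable_bounded_ratio mu K0 H1 H2).
- exact: (mass_comparable_bounded_ratio mu K0 H2 H3).
- exact: (mass_comparable_bounded_ratio mu K0 H3 H4).
Qed.
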